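(* Let $K$ be a locally closed convex subset of a cartesian space, and let $F\colon K\to\mathbb{R}^n$ be a map. Then $F$ is diffeologically smooth if and only if it is Sikorski smooth.
   Context: ''Smooth'' means $C^\infty$. A cartesian space is $\mathbb{R}^d$ for some $d\in\mathbb{N}$, with its standard smooth structure. A subset of $\mathbb{R}^d$ is locally closed if it is the intersection of an open and a closed subset of $\mathbb{R}^d$. A Sikorski structure on a set $X$ is a non-empty collection $\mathcal{F}_X$ of real-valued functions on $X$ such that, with $X$ equipped with the initial topology (the weakest topology making all functions in $\mathcal{F}_X$ continuous): (S1) if $f_1,\ldots,f_n\in\mathcal{F}_X$ and $g\in C^\infty(\mathbb{R}^n)$, then $g\circ(f_1,\ldots,f_n)\in\mathcal{F}_X$; (S2) given $f\colon X\to\mathbb{R}$, if for each point of $X$ there exist a neighbourhood $V$ and $g\in\mathcal{F}_X$ with $g|_V=f|_V$, then $f\in\mathcal{F}_X$. A map $(X,\mathcal{F}_X)\to(Y,\mathcal{F}_Y)$ is Sikorski smooth if its composition with every function in $\mathcal{F}_Y$ is in $\mathcal{F}_X$. $\mathbb{R}^n$ carries the Sikorski structure $C^\infty(\mathbb{R}^n)$. A subset $K\subseteq\mathbb{R}^d$ carries the subspace Sikorski structure: the set of $f\colon K\to\mathbb{R}$ such that each point of $K$ has a neighbourhood $W$ in $\mathbb{R}^d$ and a function $g\in C^\infty(\mathbb{R}^d)$ with $g|_{K\cap W}=f|_{K\cap W}$. A diffeology on a set $X$ is a collection $\mathcal{D}_X$ of maps (plots) from open subsets of cartesian spaces to $X$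 such that: (D1) constant maps are plots; (D2) precompositions of plots with $C^\infty$ maps between open subsets of cartesian spaces are plots; (D3) $p\colon U\to X$ is a plot if each point of $U$ has a neighbourhood $V$ with $p|_V$ a plot. A map between diffeological spaces is diffeologically smooth if its precomposition with every plot of the source is a plot of the target. $\mathbb{R}^n$ carries the diffeology of all $C^\infty$ maps from open subsets of cartesian spaces to $\mathbb{R}^n$. A subset $K\subseteq\mathbb{R}^d$ carries the subset diffeology: the set of maps $p\colon U\to K$ from open subsets $U$ of cartesian spaces that are $C^\infty$ as maps to $\mathbb{R}^d$. *)

(* Defs.v *)
From HB Require Import structures.
From mathcomp Require Import all_boot all_order all_algebra.
From mathcomp Require Import all_classical all_reals all_analysis.
Set Implicit Arguments.
Unset Strict Implicit.
Unset Printing Implicit Defensive.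
Import Order.TTheory GRing.Theory Num.Theory.
Import numFieldNormedType.Exports.
Local Open Scope classical_set_scope.
Local Open Scope ring_scope.

(* The cartesian space R^d is 'rV[R]_d, for every d : nat (d = 0 included).
   A map defined on a subset A of R^d is a function on the subtype A,
   through the coercion of A to {x | x \in A}. *)

(* Partial derivatives of f up to order k exist and are continuous on U.
   Both conditions at a point x depend only on f near x, so for an open set U
   the values of f outside U play no role. *)
Fixpoint Ck_on (R : realType) (m : nat) (V : normedModType R) (k : nat)
    (U : set 'rV[R]_m) (f : 'rV[R]_m -> V) : Prop :=
  (forall x, U x -> {for x, continuous f}) /\
  match k with
  | 0%N => True
  | k'.+1 => forall i : 'I_m,
      (forall x, U x -> derivable f x (delta_mx 0 i)) /\
      Ck_on k' U ('D_(delta_mx 0 i) f)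
  end.

Definition smooth_on (R : realType) (m : nat) (V : normedModType R)
    (U : set 'rV[R]_m) (f : 'rV[R]_m -> V) : Prop :=
  forall k, Ck_on k U f.

(* For p defined only on an open set U: the total function g represents p on U
   and is arbitrary elsewhere, so nothing is required at the boundary of U. *)
Definition smooth_map (R : realType) (m : nat) (V : normedModType R)
    (U : set 'rV[R]_m) (p : U -> V) : Prop :=
  exists2 g : 'rV[R]_m -> V,
    smooth_on U g & forall u : U, p u = g (\val u).

Definition locally_closed (T : topologicalType) (K : set T) : Prop :=
  exists O C : set T, [/\ open O, closed C & K = O `&` C].

(* Smoothness of maps involves only the underlying collections of functions
   or of plots, so structures are represented by these collections. *)

Definition sikorski_smooth (R : realType) (X Y : Type)
    (FX : set (X -> R)) (FY : set (Y -> R)) (f : X -> Y) : Prop :=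
  forall g, FY g -> FX (g \o f).

Definition cartesian_sikorski (R : realType) (n : nat) :
    set ('rV[R]_n -> R) :=
  [set g | smooth_on setT (g : 'rV[R]_n -> R^o)].

Definition subspace_sikorski (R : realType) (d : nat) (K : set 'rV[R]_d) :
    set (K -> R) :=
  [set f | forall x : K, exists W : set 'rV[R]_d, nbhs (\val x) W /\
     exists2 g, cartesian_sikorski g &
       forall y : K, W (\val y) -> g (\val y) = f y].

Definition plots (R : realType) (X : Type) : Type :=
  forall (m : nat) (U : set 'rV[R]_m), set (U -> X).

Definition diffeologically_smooth (R : realType) (X Y : Type)
    (DX : plots R X) (DY : plots R Y) (f : X -> Y) : Prop :=
  forall (m : nat) (U : set 'rV[R]_m) (p : U -> X),
    DX m U p -> DY m U (f \o p).

Definition cartesian_diffeology (R : realType) (n : nat) :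
    plots R 'rV[R]_n :=
  fun m U => [set p | open U /\ smooth_map p].

Definition subset_diffeology (R : realType) (d : nat) (K : set 'rV[R]_d) :
    plots R K :=
  fun m U => [set p | open U /\ smooth_map (fun u : U => \val (p u))].

(* Main.v *)
Require Import Defs.
From mathcomp Require Import all_boot all_order all_algebra.
From mathcomp Require Import all_classical all_reals all_analysis.
From mathcomp Require Import ring lra.
Import Order.TTheory GRing.Theory Num.Theory.
Import numFieldNormedType.Exports.

(** That Sikorski smoothness implies diffeological smoothness is the chain
    rule. For the converse, it suffices to show that a real function [f] that is
    smooth along every plot of [K] coincides, near each point [x0] of [K], with
    a smooth function on the whole space. Cutting [K] with a small closed ball
    and passing to the affine hull, one may assume that [K] is compact and
    contains a ball around some point [c]. Then [f] is smooth in the interior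
    of [K], and two things remain.

    The derivatives of [f] are bounded in the interior. Otherwise one of them,
    of order [k], blows up along a sequence [x n] that converges to a point of
    [K], fast enough for a smooth curve [gam] in [K] to pass through all of its
    terms ([special_curve]). The map sending [(v, t, s)] to
    [(1 - s^2) gam t + s^2 (c + v)] is a plot of [K], since [s^2 >= 0] whatever
    the sign of [s]. A derivative of order [k] in [v] of [f] along this plot is
    [s^(2k)] times the derivative of [f] ([partials_probe]); deriving it [2k]
    more times in [s] at [s = 0] gives, at the parameter of [x n], the
    derivative of [f] at [x n] up to the factor [(2k)!]. The result is
    continuous, hence bounded, as [t] tends to [0], a contradiction
    ([partials_bounded_near]).

    A function with bounded derivatives extends ([smooth_extension]). Put
    [w = c - x0]. Near [x0], the translation by [t w] sends the points at
    distance less than [t rho] from [K] into the interior. With [S] the translation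
    by [e w], the operator [1 - (1 - S)^m] is a combination of positive powers
    of [S], so it makes sense on the [e rho]-neighbourhood of [K], where it
    produces an approximation of [f] which is smooth beyond [K]. The error is a
    finite difference of order [m], of size [e^m] by the mean value theorem;
    so is, for all derivatives at once, the change caused by halving [e] or
    by increasing [m] ([shift_sum_Ck_bounded]). Multiplying this change by a
    cutoff equal to [1] on [K], at scale [e], costs a fixed power of [1 / e] in
    the C^k norm ([cutoff]), which [e^m] compensates once [m > k + d]. Summing
    the changes over [e = 2 ^- n], with an order [m] that tends to infinity
    slowly enough for the constants to be absorbed, gives a series that
    converges in every C^k norm; on [K] its sum is [f] ([glue]). *)

Set Implicit Arguments.
Unset Strict Implicit.
Unset Printing Implicit Defensive.
#[local] Open Scope classical_set_scope.
#[local] Open Scope ring_scope.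

(** * Derivatives along lines and first order expansions *)

Section line.
Variables (R : realType) (V : normedModType R).
Implicit Types (u : V -> R) (x v : V).

Lemma is_derive_epsP u x v D :
  is_derive x v u D <->
  forall e, 0 < e -> exists2 d, 0 < d &
    forall h : R, `|h| < d -> `|u (h *: v + x) - u x - h * D| <= e * `|h|.
Proof.
split=> [[+ <-] e e0|H].
  move=> /cvgrPdist_le /= /(_ e e0) [d /= d0 H]; exists d => // h hd.
  have [->|h0] := eqVneq h 0.
    by rewrite scale0r add0r subrr mul0r subr0 normr0 mulr0.
  have := H h; rewrite /ball_/= sub0r normrN => /(_ hd h0).
  rewrite -(ler_pM2l (x := `|h|)) ?normr_gt0// -normrM mulrBr.
  by rewrite /GRing.scale/= mulrA divff// mul1r [e * _]mulrC distrC.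
have: (fun h => h^-1 *: ((u \o shift x) (h *: v) - u x)) @ 0^' --> D.
  apply/cvgrPdist_le => /= e e0.
  have [d d0 {}H] := H e e0; exists d => //= h; rewrite /ball_/= sub0r normrN.
  move=> hd h0; rewrite -(ler_pM2l (x := `|h|)) ?normr_gt0// -normrM mulrBr.
  by rewrite /GRing.scale/= mulrA divff// mul1r [`|h| * _]mulrC distrC H.
by move=> H'; split; [apply/cvg_ex; exists D | exact: cvg_lim H'].
Qed.

End line.

Section mean_value.
Variables (R : realType) (V : normedModType R).
Implicit Types (u : V -> R) (x v : V).

Lemma is_derive_line u z v (s : R) : derivable u (s *: v + z) v ->
  is_derive s (1 : R) (fun t : R => u (t *: v + z)) ('D_v u (s *: v + z)).
Proof.
move=> /derivableP H; have E : forall h,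
   h^-1 *: (u (h *: v + (s *: v + z)) - u (s *: v + z))
   = h^-1 *: (u ((h *: (1:R) + s) *: v + z) - u (s *: v + z)).
  by move=> h; rewrite scalerDl addrA [h *: 1]mulr1.
case: H => H1 H2; split.
- by rewrite /derivable /=; under eq_fun do rewrite /= -E.
- by rewrite /derive /=; under eq_fun do rewrite /= -E.
Qed.

(** The mean value is taken at [s * t] with [s] in the unit interval, which
    treats both signs of [t] at once. *)
Lemma MVT_line u z v (t : R) :
  (forall s : R, 0 <= s <= 1 -> derivable u ((s * t) *: v + z) v) ->
  exists2 s : R, 0 <= s <= 1 &
    u (t *: v + z) - u z = t * 'D_v u ((s * t) *: v + z).
Proof.
move=> H; pose g (s : R) := u ((s * t) *: v + z).
pose dg (s : R) := t * 'D_v u ((s * t) *: v + z).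
have gP (s : R) : s \in `[0, 1] -> is_derive s (1 : R) g (dg s).
  rewrite in_itv/= => /H du.
  have dM : is_derive s (1 : R) (fun s : R => s * t : R) t.
    apply/is_derive_epsP => e e0; exists 1 => // h _.
    by rewrite [h *: 1]mulr1 mulrDl addrK subrr normr0 mulr_ge0// ltW.
  rewrite /dg mulrC.
  have dL := is_derive_line du.
  have dC := @is_derive1_comp R (fun s : R => u (s *: v + z)) (fun s : R => s * t)
    s ('D_v u ((s * t) *: v + z)) t dL dM.
  exact: dC.
have goo (s : R) : s \in `]0, 1[ -> is_derive s (1 : R) g (dg s).
  by move=> /subset_itv_oo_cc /gP.
have gc : {within `[0, 1], continuous g}.
  by apply: derivable_within_continuous => s /gP [].
have [s s01 E] := MVT_segment ler01 goo gc.
exists s; first by move: s01; rewrite in_itv.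
by move: E; rewrite /g /dg mul0r scale0r add0r mul1r subr0 mulr1.
Qed.

End mean_value.

Section rowvec.
Variable R : realType.

Lemma row_norm_le n (x : 'rV[R]_n) e : 0 <= e ->
  (forall j, `|x 0 j| <= e) <-> `|x| <= e.
Proof.
move=> e0; rewrite [`|x|]/Num.Def.normr/= mx_normrE; split=> [H|H j].
  by apply: bigmax_le => // -[i j] _ /=; rewrite (ord1 i).
by apply: le_trans H; exact: (le_bigmax _ _ (0, j)).
Qed.

Lemma row_norm_lt n (x : 'rV[R]_n) e : 0 < e ->
  (forall j, `|x 0 j| < e) <-> `|x| < e.
Proof.
move=> e0; rewrite [`|x|]/Num.Def.normr/= mx_normrE; split=> [H|H j].
  by apply: bigmax_lt => // -[i j] _ /=; rewrite (ord1 i).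
by apply: le_lt_trans H; exact: (le_bigmax _ _ (0, j)).
Qed.

Lemma coord_norm_le n (x : 'rV[R]_n) j : `|x 0 j| <= `|x|.
Proof. by have [_] := row_norm_le x (normr_ge0 x); apply. Qed.

Lemma norm_delta_le n (j : 'I_n) : `|delta_mx 0 j : 'rV[R]_n| <= 1.
Proof.
by apply/row_norm_le => // i; rewrite mxE eqxx/=; case: (_ == _); rewrite ?normr1 ?normr0.
Qed.

(** Moving one coordinate at a time from [y0] to [y] and applying the mean
    value theorem to each move. *)
Lemma C1_frechet n (W : set 'rV[R]_n) (u : 'rV[R]_n -> R) y0 :
  open W -> W y0 ->
  (forall j x, W x -> derivable u x (delta_mx 0 j)) ->
  (forall j, {for y0, continuous ('D_(delta_mx 0 j) u)}) ->
  forall e, 0 < e -> exists2 d, 0 < d & forall y, `|y - y0| < d ->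
   `|u y - u y0 - \sum_j (y 0 j - y0 0 j) * 'D_(delta_mx 0 j) u y0|
      <= e * `|y - y0|.
Proof.
move=> oW Wy0 du cu e e0.
pose e' := e / n.+1%:R; have e'0 : 0 < e' by rewrite divr_gt0.
have [d d0 H] : exists2 d, 0 < d & forall y, `|y - y0| < d -> W y /\
    forall j, `|'D_(delta_mx 0 j) u y - 'D_(delta_mx 0 j) u y0| <= e'.
  have : \forall y \near y0, W y /\
      forall j, `|'D_(delta_mx 0 j) u y - 'D_(delta_mx 0 j) u y0| <= e'.
    suff : \forall y \near y0, forall j,
        `|'D_(delta_mx 0 j) u y - 'D_(delta_mx 0 j) u y0| <= e'.
      by apply: filterS2; [move=> x; exact: conj | exact: open_nbhs_nbhs].
    apply: (@filter_forall _ 'I_n (fun j y =>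
      `|'D_(delta_mx 0 j) u y - 'D_(delta_mx 0 j) u y0| <= e') (nbhs y0) _) => j.
    have /cvgrPdist_le /(_ e' e'0) := cu j.
    by apply: filterS => y; rewrite distrC.
  move=> /nbhs_ballP [d /= d0 H]; exists d => // y yd; apply: H.
  by rewrite -ball_normE /= distrC.
exists d => // y yd.
pose z k : 'rV[R]_n := \row_j if (j < k)%N then y 0 j else y0 0 j.
have zE (k : 'I_n) : z k.+1 = (y 0 k - y0 0 k) *: delta_mx 0 k + z k.
  apply/rowP => j; rewrite !mxE eqxx /= ltnS leq_eqVlt.
  have [->|jk] := eqVneq j k; first by rewrite eqxx ltnn mulr1 subrK.
  by rewrite mulr0 add0r; move: jk; rewrite -val_eqE => /negPf ->.
have z0 : z 0%N = y0 by apply/rowP => j; rewrite mxE.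
have zn : z n = y by apply/rowP => j; rewrite mxE ltn_ord.
have -> : u y - u y0 = \sum_(k < n) (u (z k.+1) - u (z k)).
  rewrite -[in u y]zn -[in u y0]z0.
  by rewrite -(telescope_sumr (fun k => u (z k)) (leq0n n)) big_mkord.
rewrite -sumrB.
apply: le_trans (ler_norm_sum _ _ _) _.
apply: (@le_trans _ _ (\sum_(j < n) e' * `|y - y0|)); last first.
  rewrite sumr_const card_ord -[leLHS]mulr_natr mulrAC ler_wpM2r//.
  rewrite /e' -mulrA ler_piMr ?(ltW e0)//.
  by rewrite mulrC ler_pdivrMr// mul1r ler_nat.
apply: ler_sum => k _.
have zb s : `|s| <= `|y 0 k - y0 0 k| -> `|s *: delta_mx 0 k + z k - y0| < d.
  move=> sk; apply: le_lt_trans yd; apply/row_norm_le => // j.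
  have yy j' : `|y 0 j' - y0 0 j'| <= `|y - y0|.
    by have := coord_norm_le (y - y0) j'; rewrite !mxE.
  rewrite !mxE eqxx/=; have [->|jk] := eqVneq j k.
    by rewrite ltnn mulr1 addrK (le_trans sk).
  by rewrite mulr0 add0r; case: ifP => // _; rewrite subrr normr0.
have st (s : R) : 0 <= s <= 1 ->
    `|s * (y 0 k - y0 0 k)| <= `|y 0 k - y0 0 k|.
  by move=> /andP[s0 s1]; rewrite normrM (ger0_norm s0) ler_piMl.
have [|s /st sk] := @MVT_line R _ u (z k) (delta_mx 0 k) (y 0 k - y0 0 k).
  by move=> s /st /zb /H [Ws _]; exact: du.
rewrite -zE => ->; rewrite -mulrBr normrM mulrC ler_pM//.
  by have /H [_] := zb _ sk; apply.
by have := coord_norm_le (y - y0) k; rewrite !mxE.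
Qed.

End rowvec.

(** * Functions of class C^k *)

Section Ck_generic.
Variables (R : realType) (m : nat) (V : normedModType R).
Implicit Types (U W : set 'rV[R]_m) (f g : 'rV[R]_m -> V).

Lemma Ck_onS k U f : Ck_on k.+1 U f -> Ck_on k U f.
Proof.
elim: k f => [|k IH] f [cf H]; first by split.
by split=> // i; have [df /IH] := H i.
Qed.

Lemma Ck_on_continuous k U f x : Ck_on k U f -> U x -> {for x, continuous f}.
Proof. by case: k => [|k] [cf _] /cf. Qed.

(** The clauses of [Ck_on] are pointwise statements about a total function. *)
Lemma Ck_on_local k U f :
  (forall x, U x -> exists2 W : set 'rV[R]_m, W x & Ck_on k W f) -> Ck_on k U f.
Proof.
elim: k f => [|k IH] f H.
  by split=> // x /H [W Wx [+ _]]; apply.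
split=> [x /H [W Wx [+ _]]|i]; first exact.
split=> [x /H [W Wx [_ /(_ i) [+ _]]]|]; first exact.
by apply: IH => x /H [W Wx [_ /(_ i) [_ ?]]]; exists W.
Qed.

Lemma Ck_on_sub k U W f : U `<=` W -> Ck_on k W f -> Ck_on k U f.
Proof. by move=> UW Wf; apply: Ck_on_local => x /UW Wx; exists W. Qed.

Lemma Ck_on_eq k U f g : open U -> (forall x, U x -> f x = g x) ->
  Ck_on k U f -> Ck_on k U g.
Proof.
move=> oU; have near_fg f' g' : (forall x, U x -> f' x = g' x :> V) ->
    forall x, U x -> \near x, f' x = g' x.
  move=> fg x Ux; have : nbhs x U by exact: open_nbhs_nbhs.
  exact: filterS.
have cg f' g' : (forall x, U x -> f' x = g' x :> V) ->
    (forall x, U x -> {for x, continuous f'}) ->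
    forall x, U x -> {for x, continuous g'}.
  move=> fg cf x Ux; have : f' @ x --> g' x by rewrite -(fg x Ux); exact: cf.
  exact: cvg_trans (near_eq_cvg (near_fg _ _ fg _ Ux)).
elim: k f g => [|k IH] f g fg [cf H]; first by split=> //; exact: cg cf.
split=> [|i]; first exact: cg cf.
 have [df Hi] := H i; split.
  by move=> x Ux; apply: near_eq_derivable (df x Ux); exact: near_fg.
by apply: IH Hi => x Ux; apply: near_eq_derive; exact: near_fg.
Qed.

Lemma Ck_onI k U f (df : 'I_m -> 'rV[R]_m -> V) : open U ->
  (forall x, U x -> {for x, continuous f}) ->
  (forall i x, U x -> is_derive x (delta_mx 0 i) f (df i x)) ->
  (forall i, Ck_on k U (df i)) -> Ck_on k.+1 U f.
Proof.
move=> oU cf Hdf Cdf; split=> // i; split=> [x /(Hdf i) []//|].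
by apply: Ck_on_eq (Cdf i) => // x /(Hdf i) [].
Qed.

Lemma smooth_on_partial U f i : smooth_on U f ->
  smooth_on U ('D_(delta_mx 0 i) f).
Proof. by move=> sf k; have [_ /(_ i) []] := sf k.+1. Qed.

End Ck_generic.

Section coordinate.
Variable R : realType.

Lemma is_derive_coord m i j (x : 'rV[R]_m) :
  is_derive x (delta_mx 0 i) (fun x : 'rV[R]_m => x 0 j) (i == j)%:R.
Proof.
apply/is_derive_epsP => e e0; exists 1 => // h _.
by rewrite !mxE addrK eqxx eq_sym/= subrr normr0 mulr_ge0// ltW.
Qed.

End coordinate.

Section Ck_real.
Variables (R : realType) (m : nat) (U : set 'rV[R]_m).
Hypothesis oU : open U.
Implicit Types (f g : 'rV[R]_m -> R).

Lemma Ck_on_cst k (c : R) : Ck_on k U (fun=> c).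
Proof.
elim: k c => [|k IH] c; first by split=> // x _; exact: cst_continuous.
apply: Ck_onI (fun _ _ => 0) _ _ _ _ => //.
- by move=> x _; exact: cst_continuous.
Qed.

Lemma Ck_on_add k f g :
  Ck_on k U f -> Ck_on k U g -> Ck_on k U (fun x => f x + g x).
Proof.
elim: k f g => [|k IH] f g [cf Hf] [cg Hg].
  by split=> // x Ux; exact: continuousD (cf _ Ux) (cg _ Ux).
apply: (Ck_onI (df := fun i x => 'D_(delta_mx 0 i) f x + 'D_(delta_mx 0 i) g x)) => //.
- by move=> x Ux; exact: continuousD (cf _ Ux) (cg _ Ux).
- move=> i x Ux; apply: is_deriveD; apply: derivableP.
  + exact: (Hf i).1.
  + exact: (Hg i).1.
- by move=> i; apply: IH; [exact: (Hf i).2|exact: (Hg i).2].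
Qed.

Lemma Ck_on_mul k f g :
  Ck_on k U f -> Ck_on k U g -> Ck_on k U (fun x => f x * g x).
Proof.
elim: k f g => [|k IH] f g Cf Cg.
  by split=> // x Ux; exact: continuousM (Ck_on_continuous Cf Ux) (Ck_on_continuous Cg Ux).
have [cf Hf] := Cf; have [cg Hg] := Cg.
apply: (Ck_onI (df := fun i x => f x * 'D_(delta_mx 0 i) g x
                                 + g x * 'D_(delta_mx 0 i) f x)) => //.
- by move=> x Ux; exact: continuousM (cf _ Ux) (cg _ Ux).
- move=> i x Ux; apply: is_deriveM; apply: derivableP.
  + exact: (Hf i).1.
  + exact: (Hg i).1.
- move=> i; apply: Ck_on_add; apply: IH.
  + exact: Ck_onS.
  + exact: (Hg i).2.
  + exact: Ck_onS.
  + exact: (Hf i).2.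
Qed.

Lemma Ck_on_sum k I (s : seq I) (P : pred I) (f : I -> 'rV[R]_m -> R) :
  (forall j, Ck_on k U (f j)) ->
  Ck_on k U (fun x => \sum_(j <- s | P j) f j x).
Proof.
move=> Hf; elim: s => [|j s IH].
  by under eq_fun do rewrite big_nil; exact: Ck_on_cst.
under eq_fun do rewrite big_cons.
by case: (P j) => //; exact: Ck_on_add.
Qed.

Lemma Ck_on_coord k j : Ck_on k U (fun x : 'rV[R]_m => x 0 j).
Proof.
case: k => [|k]; first by split=> // x _; exact: coord_continuous.
apply: (Ck_onI (V := R) (df := fun i _ => (i == j)%:R : R)) => //.
- by move=> x _; exact: coord_continuous.
- by move=> i x _; exact: is_derive_coord.
- by move=> i; exact: Ck_on_cst.
Qed.

End Ck_real.

Section chain.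
Variable R : realType.

Lemma ball_forall n (P : 'I_n -> R -> Prop) :
  (forall j, exists2 d, 0 < d & forall h : R, `|h| < d -> P j h) ->
  exists2 d, 0 < d & forall h : R, `|h| < d -> forall j, P j h.
Proof.
move=> H.
have : \forall h \near (0 : R), forall j, P j h.
  apply: (@filter_forall _ _ P (nbhs (0:R)) _) => j.
  have [d d0 Hd] := H j; apply/nbhs_ballP; exists d => // h.
  by rewrite -ball_normE/= sub0r normrN; exact: Hd.
move=> /nbhs_ballP [d /= d0 Hd]; exists d => // h hd.
by apply: Hd; rewrite -ball_normE/= sub0r normrN.
Qed.

(** Chain rule along one direction [v]; the last hypothesis is Frechet
    differentiability of [u] at [p x], with gradient [l]. *)
Lemma is_derive_comp (V : normedModType R) n (p : V -> 'rV[R]_n)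
    (u : 'rV[R]_n -> R) (q l : 'I_n -> R) x v :
  (forall j, is_derive x v (fun y => p y 0 j) (q j)) ->
  (forall e, 0 < e -> exists2 d, 0 < d & forall y, `|y - p x| < d ->
   `|u y - u (p x) - \sum_j (y 0 j - p x 0 j) * l j| <= e * `|y - p x|) ->
  is_derive x v (u \o p) (\sum_j l j * q j).
Proof.
move=> dp du; apply/is_derive_epsP => e e0.
pose L := 1 + \sum_j `|q j|; pose M := 1 + \sum_j `|l j|.
have L0 : 0 < L by rewrite ltr_pwDl// sumr_ge0.
have M0 : 0 < M by rewrite ltr_pwDl// sumr_ge0.
have [|d1 d10 Hu] := du (e / (2 * L)); first by rewrite divr_gt0// mulr_gt0.
pose e2 := Num.min 1 (e / (2 * M)).
have e20 : 0 < e2 by rewrite lt_min ltr01 divr_gt0// mulr_gt0.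
have [d2 d20 Hp] := ball_forall (fun j =>
   (is_derive_epsP (fun y => p y 0 j) x v (q j)).1 (dp j) e2 e20).
exists (Num.min d2 (d1 / L)); first by rewrite lt_min d20 divr_gt0.
move=> h; rewrite lt_min => /andP[/Hp {}Hp0 hd1].
have {}Hp j : `|p (h *: v + x) 0 j - p x 0 j - h * q j| <= e2 * `|h|.
  exact: Hp0.
have pL : `|p (h *: v + x) - p x| <= L * `|h|.
  apply/row_norm_le => [|j]; first by rewrite mulr_ge0// ltW.
  rewrite !mxE -[X in `|X|](subrK (h * q j)).
  apply: le_trans (ler_normD _ _) _.
  rewrite /L mulrDl; apply: lerD.
    apply: le_trans (Hp j) _; rewrite ler_wpM2r// ge_min lexx//.
  rewrite normrM mulrC ler_wpM2r// (bigD1 j)//= lerDl sumr_ge0//.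
have {}Hu := Hu (p (h *: v + x)).
have /Hu {}Hu : `|p (h *: v + x) - p x| < d1.
  by apply: le_lt_trans pL _; rewrite mulrC -ltr_pdivlMr.
have E (a s t : R) : a - t = (a - s) + (s - t) by ring.
rewrite /= (E _ (\sum_j (p (h *: v + x) 0 j - p x 0 j) * l j)).
apply: le_trans (ler_normD _ _) _.
rewrite [e * _](_ : _ = e / (2 * L) * (L * `|h|) + e / (2 * M) * (M * `|h|)); last first.
  by field; rewrite !gt_eqF.
apply: lerD.
  by apply: (le_trans Hu); rewrite ler_wpM2l// divr_ge0 ?mulr_ge0// ltW.
have -> : \sum_j (p (h *: v + x) 0 j - p x 0 j) * l j - h * \sum_j l j * q j
   = \sum_j (p (h *: v + x) 0 j - p x 0 j - h * q j) * l j.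
  rewrite mulr_sumr -sumrN -big_split/=; apply: eq_bigr => j _; ring.
apply: le_trans (ler_norm_sum _ _ _) _.
apply: (@le_trans _ _ (\sum_j (e / (2 * M) * `|h|) * `|l j|)).
  apply: ler_sum => j _; rewrite normrM ler_wpM2r//.
  apply: le_trans (Hp j) _; rewrite ler_wpM2r// ge_min lexx orbT//.
rewrite -mulr_sumr -mulrA [M * _]mulrC ler_wpM2l ?divr_ge0 ?mulr_ge0 ?(ltW e0) ?(ltW M0)//.
by rewrite ler_wpM2l // lerDr.
Qed.

Lemma continuous_row (T : topologicalType) n (p : T -> 'rV[R]_n) (x : T) :
  (forall j, {for x, continuous (fun y => p y 0 j)}) -> {for x, continuous p}.
Proof.
move=> cp; apply/cvgrPdist_lt => e e0 /=.
have /= : \forall y \near x, forall j, `|p x 0 j - p y 0 j| < e.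
  apply: (@filter_forall _ _ (fun j y => `|p x 0 j - p y 0 j| < e) (nbhs x) _) => j.
  by have /cvgrPdist_lt /(_ e e0) := cp j.
by apply: filterS => y Hy; apply/row_norm_lt => // j; rewrite !mxE.
Qed.

Lemma Ck_on_comp k m n (U : set 'rV[R]_m) (W : set 'rV[R]_n)
    (p : 'rV[R]_m -> 'rV[R]_n) (u : 'rV[R]_n -> R) :
  open U -> open W -> (forall x, U x -> W (p x)) ->
  (forall j, Ck_on k U (fun x => p x 0 j)) -> Ck_on k W u ->
  Ck_on k U (u \o p).
Proof.
move=> oU oW UW; move=> Cp Cu; have cc x : U x -> {for x, continuous (u \o p)}.
  move=> Ux; apply: continuous_comp; last exact: Ck_on_continuous Cu (UW _ Ux).
  by apply: continuous_row => j; exact: Ck_on_continuous (Cp j) Ux.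
elim: k u Cp Cu cc => [|k IH] u Cp Cu cc; first by split.
apply: (Ck_onI (df := fun i x => \sum_j ('D_(delta_mx 0 j) u \o p) x
   * 'D_(delta_mx 0 i) (fun x => p x 0 j) x)) => //.
- move=> i x Ux; apply: is_derive_comp.
    by move=> j; apply: derivableP; have [_ /(_ i) [+ _]] := Cp j; apply.
  apply: (C1_frechet oW (UW _ Ux)).
    by move=> j y Wy; have [_ /(_ j) [+ _]] := Cu; apply.
  move=> j; have [_ /(_ j) [_ Cuj]] := Cu; exact: Ck_on_continuous Cuj (UW _ Ux).
- move=> i; apply: Ck_on_sum => // j; apply: Ck_on_mul => //.
    have Cuj : Ck_on k W ('D_(delta_mx 0 j) u) by have [_ /(_ j) []] := Cu.
    apply: IH => // [j'|x Ux]; first exact: Ck_onS.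
    apply: continuous_comp; last exact: Ck_on_continuous Cuj (UW _ Ux).
    by apply: continuous_row => j'; exact: Ck_on_continuous (Cp j') Ux.
  by have [_ /(_ i) []] := Cp j.
Qed.

Lemma Ck_on_rowP k m n (U : set 'rV[R]_m) (p : 'rV[R]_m -> 'rV[R]_n) :
  open U ->
  Ck_on k U p <-> forall j, Ck_on k U (fun x => p x 0 j).
Proof.
move=> oU; elim: k p => [|k IH] p.
  split=> [[cp _] j|H].
    split=> // x Ux; exact: (continuous_comp (cp x Ux) (@coord_continuous R 1 n 0 j (p x))).
  split=> // x Ux; apply: continuous_row => j; exact: Ck_on_continuous (H j) Ux.
split=> [[cp H] j|H].
  apply: (Ck_onI (df := fun i x => ('D_(delta_mx 0 i) p x) 0 j)) => //.
  - move=> x Ux; exact: (continuous_comp (cp x Ux) (@coord_continuous R 1 n 0 j (p x))).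
  - move=> i x Ux; have dp := (H i).1 x Ux.
    rewrite derive_mx// mxE; apply: derivableP.
    by have /derivable_mxP := dp; apply.
  - by move=> i; have [_ /IH] := H i; apply.
apply: (Ck_onI (df := fun i x => \row_j 'D_(delta_mx 0 i) (fun x => p x 0 j) x)) => //.
- move=> x Ux; apply: continuous_row => j; exact: Ck_on_continuous (H j) Ux.
- move=> i x Ux; have dp : derivable p x (delta_mx 0 i).
    by apply/derivable_mxP => i0 j; rewrite (ord1 i0); have [_ /(_ i) [+ _]] := H j; apply.
  split=> //; rewrite derive_mx//; apply/rowP => j; rewrite !mxE//.
- move=> i; apply/IH => j; under eq_fun do rewrite mxE.
  by have [_ /(_ i) []] := H j.
Qed.

End chain.

Section smooth.
Variable R : realType.

Lemma smooth_on_cst m (U : set 'rV[R]_m) (c : R) : open U -> smooth_on U (fun=> c).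
Proof. by move=> oU k; exact: Ck_on_cst. Qed.

Lemma smooth_on_mul m (U : set 'rV[R]_m) (f g : 'rV[R]_m -> R) : open U ->
  smooth_on U f -> smooth_on U g -> smooth_on U (fun x => f x * g x).
Proof. by move=> oU sf sg k; exact: Ck_on_mul. Qed.

Lemma smooth_on_add m (U : set 'rV[R]_m) (f g : 'rV[R]_m -> R) : open U ->
  smooth_on U f -> smooth_on U g -> smooth_on U (fun x => f x + g x).
Proof. by move=> oU sf sg k; exact: Ck_on_add. Qed.

Lemma smooth_on_coord m (U : set 'rV[R]_m) j : open U ->
  smooth_on U (fun x : 'rV[R]_m => x 0 j).
Proof. by move=> oU k; exact: Ck_on_coord. Qed.

Lemma smooth_on_exp m (U : set 'rV[R]_m) (f : 'rV[R]_m -> R) n : open U ->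
  smooth_on U f -> smooth_on U (fun x => f x ^+ n).
Proof.
move=> oU sf; elim: n => [|n IH]; first exact: smooth_on_cst.
by under eq_fun do rewrite exprS; exact: smooth_on_mul.
Qed.

Lemma smooth_on_sub m (U W : set 'rV[R]_m) (f : 'rV[R]_m -> R) : U `<=` W ->
  smooth_on W f -> smooth_on U f.
Proof. by move=> UW sf k; exact: Ck_on_sub (sf k). Qed.

Lemma smooth_on_rowP m n (U : set 'rV[R]_m) (p : 'rV[R]_m -> 'rV[R]_n) : open U ->
  smooth_on U p <-> forall j, smooth_on U (fun x => p x 0 j).
Proof.
move=> oU; split=> [sp j k|sp k]; first by have := sp k => /(Ck_on_rowP _ _ oU); apply.
by apply/Ck_on_rowP => // j; exact: sp.
Qed.

Lemma smooth_on_comp m n (U : set 'rV[R]_m) (W : set 'rV[R]_n)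
    (p : 'rV[R]_m -> 'rV[R]_n) (u : 'rV[R]_n -> R) : open U -> open W ->
  (forall x, U x -> W (p x)) -> smooth_on U p -> smooth_on W u ->
  smooth_on U (u \o p).
Proof.
move=> oU oW UW /smooth_on_rowP sp su k.
by apply: (Ck_on_comp oU oW) => // j; exact: sp.
Qed.

Lemma smooth_on_id m : smooth_on setT (@id 'rV[R]_m).
Proof.
have oT := @openT 'rV[R]_m.
by apply/smooth_on_rowP => // j; exact: smooth_on_coord.
Qed.

End smooth.

(** * Uniform bounds on derivatives and series of smooth functions *)

Section bounded.
Variables (R : realType) (m : nat).
Implicit Types (U W : set 'rV[R]_m) (f g : 'rV[R]_m -> R).

(** Bounds alone: in the lemmas below, existence and continuity of the
    derivatives come from a hypothesis [Ck_on]. *)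
Fixpoint Ck_bounded k U (M : R) f : Prop :=
  (forall x, U x -> `|f x| <= M) /\
  match k with
  | 0%N => True
  | k'.+1 => forall i : 'I_m, Ck_bounded k' U M ('D_(delta_mx 0 i) f)
  end.

Definition bounded_smooth U f :=
  smooth_on U f /\ forall k, exists M, Ck_bounded k U M f.

Lemma Ck_bounded0 k U M f x : Ck_bounded k U M f -> U x -> `|f x| <= M.
Proof. by case: k => [|k] [H _] /H. Qed.

Lemma Ck_boundedW k k' U M M' f : (k' <= k)%N -> M <= M' ->
  Ck_bounded k U M f -> Ck_bounded k' U M' f.
Proof.
move=> + MM'; elim: k' k f => [|k' IH] k f.
  by move=> _ /Ck_bounded0 H; split=> // x /H /le_trans; apply.
case: k => [//|k] kk' [H1 H2]; split=> [x /H1 /le_trans|i]; first exact.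
exact: IH (H2 i).
Qed.

Lemma Ck_bounded_eq k U M f g : open U -> (forall x, U x -> f x = g x) ->
  Ck_bounded k U M f -> Ck_bounded k U M g.
Proof.
move=> oU; elim: k f g => [|k IH] f g fg [H1 H2].
  by split=> // x Ux; rewrite -fg// H1.
split=> [x Ux|i]; first by rewrite -fg// H1.
apply: IH (H2 i) => x Ux; apply: near_eq_derive.
have : nbhs x U by exact: open_nbhs_nbhs.
exact: filterS.
Qed.

Lemma Ck_bounded_local k U M f :
  (forall x, U x -> exists2 W : set 'rV[R]_m, W x & Ck_bounded k W M f) ->
  Ck_bounded k U M f.
Proof.
elim: k f => [|k IH] f H.
  by split=> // x /H [W Wx [+ _]]; apply.
split=> [x /H [W Wx [+ _]]|i]; first exact.
by apply: IH => x /H [W Wx [_ B]]; exists W => //; exact: B.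
Qed.

Lemma Ck_bounded_sub k U W M f : U `<=` W ->
  Ck_bounded k W M f -> Ck_bounded k U M f.
Proof. by move=> UW B; apply: Ck_bounded_local => x /UW Wx; exists W. Qed.

Variable U : set 'rV[R]_m.
Hypothesis oU : open U.

Lemma Ck_bounded_cst k (c : R) : Ck_bounded k U `|c| (fun=> c).
Proof.
suff H M : `|c| <= M -> Ck_bounded k U M (fun=> c) by exact: H.
elim: k c => [|k IH] c cM; first by split.
split=> // i; apply: (Ck_bounded_eq (f := fun=> 0)) => //.
  by move=> x _; rewrite derive_cst.
by apply: IH; rewrite normr0 (le_trans _ cM).
Qed.

Lemma Ck_bounded_add k M N f g : Ck_on k U f -> Ck_on k U g ->
  Ck_bounded k U M f -> Ck_bounded k U N g ->
  Ck_bounded k U (M + N) (fun x => f x + g x).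
Proof.
elim: k f g => [|k IH] f g [cf Hf] [cg Hg] [bf Bf] [bg Bg]; split=> //.
- by move=> x Ux; rewrite (le_trans (ler_normD _ _))// lerD ?bf ?bg.
- by move=> x Ux; rewrite (le_trans (ler_normD _ _))// lerD ?bf ?bg.
move=> i; have [df Cf] := Hf i; have [dg Cg] := Hg i.
apply: Ck_bounded_eq (IH _ _ Cf Cg (Bf i) (Bg i)) => // x Ux.
by rewrite deriveD//; [exact: df|exact: dg].
Qed.

(** The factor [2 ^+ k] counts the terms of the Leibniz formula. *)
Lemma Ck_bounded_mul k M N f g : Ck_on k U f -> Ck_on k U g ->
  0 <= M -> 0 <= N ->
  Ck_bounded k U M f -> Ck_bounded k U N g ->
  Ck_bounded k U (2 ^+ k * (M * N)) (fun x => f x * g x).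
Proof.
move=> + + M0 N0.
elim: k f g => [|k IH] f g Cf Cg Bf Bg; split=> //.
- by move=> x Ux; rewrite expr0 mul1r normrM ler_pM// ?(Ck_bounded0 Bf) ?(Ck_bounded0 Bg).
- move=> x Ux; rewrite normrM.
  apply: (@le_trans _ _ (M * N)).
    by rewrite ler_pM// ?(Ck_bounded0 Bf) ?(Ck_bounded0 Bg).
  by rewrite ler_peMl ?mulr_ge0// exprn_ege1// ler1n.
have [cf Hf] := Cf; have [cg Hg] := Cg; have [_ Bf'] := Bf; have [_ Bg'] := Bg.
move=> i; have [df Cf'] := Hf i; have [dg Cg'] := Hg i.
have Bf1 := Ck_boundedW (leqnSn k) (lexx M) Bf.
have Bg1 := Ck_boundedW (leqnSn k) (lexx N) Bg.
have Cf1 := Ck_onS Cf; have Cg1 := Ck_onS Cg.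
rewrite (_ : 2 ^+ k.+1 * (M * N) = 2 ^+ k * (M * N) + 2 ^+ k * (M * N)); last first.
  by rewrite exprS; ring.
have B1 := IH _ _ Cf1 Cg' Bf1 (Bg' i); have B2 := IH _ _ Cf' Cg1 (Bf' i) Bg1.
have B := Ck_bounded_add (Ck_on_mul oU Cf1 Cg') (Ck_on_mul oU Cf' Cg1) B1 B2.
apply: (Ck_bounded_eq oU _ B) => x Ux.
by rewrite deriveM// ?[in RHS]/GRing.scale/=; [rewrite [g x * _]mulrC|exact: df|exact: dg].
Qed.

Lemma Ck_bounded_scale k M (c : R) f : Ck_on k U f ->
  Ck_bounded k U M f -> Ck_bounded k U (`|c| * M) (fun x => c * f x).
Proof.
elim: k f => [|k IH] f [cf Hf] [bf Bf]; split=> //.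
- by move=> x Ux; rewrite normrM ler_wpM2l// bf.
- by move=> x Ux; rewrite normrM ler_wpM2l// bf.
move=> i; have [df Cf'] := Hf i.
apply: (Ck_bounded_eq oU _ (IH _ Cf' (Bf i))) => x Ux.
by rewrite deriveMl//; exact: df.
Qed.

Lemma Ck_bounded_sum k I (s : seq I) (P : pred I) M (f : I -> 'rV[R]_m -> R) :
  0 <= M ->
  (forall j, Ck_on k U (f j)) -> (forall j, Ck_bounded k U M (f j)) ->
  Ck_bounded k U ((size s)%:R * M) (fun x => \sum_(j <- s | P j) f j x).
Proof.
move=> M0 Cf Bf; elim: s => [|j s IH].
  under eq_fun do rewrite big_nil.
  by rewrite mul0r -[X in Ck_bounded _ _ X](normr0 R); exact: Ck_bounded_cst.
under eq_fun do rewrite big_cons.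
rewrite /= mulrSr mulrDl mul1r; case: (P j).
  by rewrite addrC; apply: Ck_bounded_add => //; exact: Ck_on_sum.
by apply: Ck_boundedW IH => //; rewrite lerDl.
Qed.

Lemma bounded_smooth_cst (c : R) : bounded_smooth U (fun=> c).
Proof.
split=> [k|k]; first exact: Ck_on_cst.
by exists `|c|; exact: Ck_bounded_cst.
Qed.

Lemma bounded_smooth_add f g : bounded_smooth U f -> bounded_smooth U g ->
  bounded_smooth U (fun x => f x + g x).
Proof.
move=> [sf bf] [sg bg]; split=> k; first exact: Ck_on_add.
have [M Mf] := bf k; have [N Ng] := bg k.
by exists (M + N); exact: Ck_bounded_add.
Qed.

Lemma bounded_smooth_mul f g : bounded_smooth U f -> bounded_smooth U g ->
  bounded_smooth U (fun x => f x * g x).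
Proof.
move=> [sf bf] [sg bg]; split=> k; first exact: Ck_on_mul.
have [M Mf] := bf k; have [N Ng] := bg k.
exists (2 ^+ k * (`|M| * `|N|)); apply: Ck_bounded_mul => //.
  exact: Ck_boundedW (leqnn k) (ler_norm M) Mf.
exact: Ck_boundedW (leqnn k) (ler_norm N) Ng.
Qed.

Lemma bounded_smooth_partial f i : bounded_smooth U f ->
  bounded_smooth U ('D_(delta_mx 0 i) f).
Proof.
move=> [sf bf]; split; first exact: smooth_on_partial.
by move=> k; have [M [_ H]] := bf k.+1; exists M; exact: H.
Qed.

Lemma bounded_smooth_eq f g : (forall x, U x -> f x = g x) ->
  bounded_smooth U f -> bounded_smooth U g.
Proof.
move=> fg [sf bf]; split=> k; first exact: Ck_on_eq (sf k).
by have [M Mf] := bf k; exists M; exact: Ck_bounded_eq Mf.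
Qed.

Lemma bounded_smooth_sum I (s : seq I) (f : I -> 'rV[R]_m -> R) :
  (forall j, bounded_smooth U (f j)) ->
  bounded_smooth U (fun x => \sum_(j <- s) f j x).
Proof.
move=> Hf; elim: s => [|j s IH].
  by under eq_fun do rewrite big_nil; exact: bounded_smooth_cst.
by under eq_fun do rewrite big_cons; exact: bounded_smooth_add.
Qed.

Lemma bounded_smooth_prod I (s : seq I) (f : I -> 'rV[R]_m -> R) :
  (forall j, bounded_smooth U (f j)) ->
  bounded_smooth U (fun x => \prod_(j <- s) f j x).
Proof.
move=> Hf; elim: s => [|j s IH].
  by under eq_fun do rewrite big_nil; exact: bounded_smooth_cst.
by under eq_fun do rewrite big_cons; exact: bounded_smooth_mul.
Qed.

Lemma Ck_boundedS k f : (exists M, forall x, U x -> `|f x| <= M) ->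
  (forall i, exists M, Ck_bounded k U M ('D_(delta_mx 0 i) f)) ->
  exists M, Ck_bounded k.+1 U M f.
Proof.
move=> [M0 HM0] /choice [M HM]; exists (`|M0| + \sum_i `|M i|); split.
  move=> x /HM0 /le_trans; apply.
  by rewrite (le_trans (ler_norm _))// lerDl sumr_ge0.
move=> i; apply: Ck_boundedW (HM i) => //.
rewrite (le_trans (ler_norm _))// (bigD1 i)//= addrCA lerDl.
by rewrite addr_ge0// sumr_ge0.
Qed.

End bounded.

Lemma continuous_epsP (R : realType) (V W : normedModType R) (f : V -> W) x :
  {for x, continuous f} <->
  forall e : R, 0 < e -> exists2 d : R, 0 < d &
    forall y, `|y - x| < d -> `|f y - f x| <= e.
Proof.
split=> [/cvgrPdist_le H e e0|H].
  have /nbhs_ballP [d /= d0 Hd] := H e e0; exists d => // y yx.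
  by rewrite distrC; apply: Hd; rewrite -ball_normE/= distrC.
apply/cvgrPdist_le => e e0; have [d d0 Hd] := H e e0.
apply/nbhs_ballP; exists d => // y; rewrite -ball_normE/= distrC => /Hd.
by rewrite distrC.
Qed.

Section series.
Variable R : realType.

Lemma exp2N_lt (e : R) : 0 < e -> exists n, forall j, (n <= j)%N -> 2 ^- j < e.
Proof.
move=> e0; exists (Num.bound e^-1) => j /upper_nthrootP H.
by rewrite invf_plt ?posrE// exprn_gt0.
Qed.

Lemma cvg_dist_le (s : nat -> R) l c B n :
  s @ \oo --> l -> (forall N, (n <= N)%N -> `|s N - c| <= B) -> `|l - c| <= B.
Proof.
move=> sl H; apply/ler_addgt0Pr => e e0.
have /cvgrPdist_le /(_ e e0) [N _ HN] := sl.
have := H (maxn n N) (leq_maxl _ _); have := HN (maxn n N) (leq_maxr _ _) => /= H1 H2.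
have E (a : R) : l - c = (a - c) + (l - a) by ring.
rewrite (E (s (maxn n N))).
by rewrite (le_trans (ler_normD _ _))// lerD.
Qed.

Lemma geo_tail (s : nat -> R) J :
  (forall n, (J <= n)%N -> `|s n.+1 - s n| <= 2 ^- n) ->
  exists2 l, s @ \oo --> l & forall n, (J <= n)%N -> `|l - s n| <= 2 * 2 ^- n.
Proof.
move=> H.
have A n p : (J <= n)%N -> `|s (n + p)%N - s n| <= 2 * 2 ^- n - 2 * 2 ^- (n + p).
  move=> Jn; elim: p => [|p IH]; first by rewrite addn0 !subrr normr0.
  have E : s (n + p.+1)%N - s n = (s (n + p).+1 - s (n + p)%N) + (s (n + p)%N - s n).
    by rewrite addnS; ring.
  rewrite E (le_trans (ler_normD _ _))//.
  have := H (n + p)%N (leq_trans Jn (leq_addr _ _)).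
  rewrite addnS exprS invfM; set a := `|_|; set b := `|_| in IH *; lra.
have A' n N : (J <= n)%N -> (n <= N)%N -> `|s N - s n| <= 2 * 2 ^- n.
  move=> Jn nN; have := A n (N - n)%N Jn; rewrite subnKC// => /le_trans; apply.
  by rewrite lerBlDr lerDl mulr_ge0// invr_ge0 exprn_ge0.
have : cvg (s @ \oo).
  apply/cauchy_cvgP/cauchy_exP => e e0.
  have [|n0 Hn] := @exp2N_lt (e / 2); first by rewrite divr_gt0.
  pose n := maxn J n0; exists (s n); exists n => // N /= nN.
  rewrite /ball/= distrC (le_lt_trans (A' _ _ (leq_maxl _ _) nN))//.
  have := Hn n (leq_maxr _ _); lra.
move=> /cvg_ex [l sl]; exists l => // n Jn.
by apply: cvg_dist_le sl (A' n ^~ Jn).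
Qed.

Variable m : nat.
Implicit Types u : nat -> 'rV[R]_m -> R.

(** Every C^k norm is eventually dominated by a geometric series, from a rank
    that depends on [k]. *)
Definition series_bounded u := forall k, exists J, forall j, (J <= j)%N ->
  Ck_bounded k setT (2 ^- j) (u j).

Lemma series_bounded_partial u i : series_bounded u ->
  series_bounded (fun j => 'D_(delta_mx 0 i) (u j)).
Proof. by move=> H k; have [J HJ] := H k.+1; exists J => j /HJ [_ B]; exact: B. Qed.

Lemma series_bounded_cvg u x : series_bounded u ->
  cvg ((fun n => \sum_(j < n) u j x) @ \oo).
Proof.
move=> /(_ 0%N) [J HJ]; have [|l Hl _] := @geo_tail (fun n => \sum_(j < n) u j x) J.
  move=> n /HJ [H _]; rewrite big_ord_recr/= addrAC subrr add0r; exact: H.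
by apply/cvg_ex; exists l.
Qed.

Definition series_sum u x := lim ((fun n => \sum_(j < n) u j x) @ \oo).

Lemma series_sum_tail u : series_bounded u -> exists J, forall n x, (J <= n)%N ->
  `|series_sum u x - \sum_(j < n) u j x| <= 2 * 2 ^- n.
Proof.
move=> /(_ 0%N) [J HJ]; exists J => n x Jn.
have [|l Hl] := @geo_tail (fun n => \sum_(j < n) u j x) J.
  move=> n' /HJ [H _]; rewrite big_ord_recr/= addrAC subrr add0r; exact: H.
by rewrite /series_sum (cvg_lim _ Hl)//; apply.
Qed.

Lemma is_derive_sumn u (du : nat -> R) x v n :
  (forall j, (j < n)%N -> is_derive x v (u j) (du j)) ->
  is_derive x v (fun y => \sum_(j < n) u j y) (\sum_(j < n) du j).
Proof.
elim: n => [|n IH] H.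
  by under eq_fun do rewrite big_ord0; rewrite big_ord0; exact: is_derive_cst.
under eq_fun do rewrite big_ord_recr/=; rewrite big_ord_recr/=.
have dn := H n (ltnSn n); apply: is_deriveD.
by apply: IH => j jn; apply: H; exact: ltnW.
Qed.

(** The difference quotients of the tails are controlled by the tails of the
    series of derivatives, through the mean value theorem. *)
Lemma series_sum_derive u i x :
  (forall j y, derivable (u j) y (delta_mx 0 i)) ->
  series_bounded u ->
  is_derive x (delta_mx 0 i) (series_sum u)
    (series_sum (fun j => 'D_(delta_mx 0 i) (u j)) x).
Proof.
move=> du bu; apply/is_derive_epsP => e e0.
have bdu := series_bounded_partial i bu.
have [J1 H1] := series_sum_tail bdu.
have [|n0 Hn] := @exp2N_lt (e / 8); first by rewrite divr_gt0.
pose n := maxn J1 n0; have en : 2 * 2 ^- n <= e / 4.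
  have := Hn n (leq_maxr _ _); lra.
have dS N y : is_derive y (delta_mx 0 i) (fun y => \sum_(j < N) u j y)
     (\sum_(j < N) 'D_(delta_mx 0 i) (u j) y).
  apply: (is_derive_sumn (du := fun j => 'D_(delta_mx 0 i) (u j) y)) => j _.
  exact: derivableP.
have /is_derive_epsP /(_ (e / 4)) [|d d0 Hd] := dS n x; first by rewrite divr_gt0.
exists d => // h /Hd {}Hd.
set v := delta_mx 0 i in Hd *.
pose S N y := \sum_(j < N) u j y.
have T1 : `|(series_sum u (h *: v + x) - series_sum u x) - (S n (h *: v + x) - S n x)|
    <= 2 * (e / 4) * `|h|.
  apply: (@cvg_dist_le (fun N => S N (h *: v + x) - S N x) _ _ _ n).
    have C y : (fun N => S N y) @ \oo --> series_sum u y by exact: series_bounded_cvg.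
    exact: (cvgB (C (h *: v + x)) (C x)).
  move=> N nN.
  have dSn y : is_derive y v (fun y => S N y - S n y)
     (\sum_(j < N) 'D_v (u j) y - \sum_(j < n) 'D_v (u j) y).
    by apply: is_deriveB; exact: dS.
  have -> : S N (h *: v + x) - S N x - (S n (h *: v + x) - S n x) =
    (S N (h *: v + x) - S n (h *: v + x)) - (S N x - S n x) by ring.
  have [|s _ ->] := @MVT_line R _ (fun y => S N y - S n y) x v h.
    by move=> s _; have [] := dSn ((s * h) *: v + x).
  rewrite normrM [leRHS]mulrC ler_wpM2l//.
  have [_ ->] := dSn ((s * h) *: v + x).
  have E (l a b : R) : a - b = (l - b) - (l - a) by ring.
  rewrite (E (series_sum (fun j => 'D_v (u j)) ((s * h) *: v + x))).
  rewrite (le_trans (ler_normB _ _))//.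
  rewrite mulrDl mul1r lerD// (le_trans (H1 _ _ _))// ?leq_maxl//.
    by rewrite (leq_trans _ nN)// leq_maxl.
  apply: le_trans en; rewrite ler_wpM2l// lef_pV2 ?posrE ?exprn_gt0//.
  by rewrite ler_eXn2l// ltr1n.
have T2 := H1 n x (leq_maxl _ _).
have E : series_sum u (h *: v + x) - series_sum u x -
  h * series_sum (fun j => 'D_v (u j)) x =
  ((series_sum u (h *: v + x) - series_sum u x) - (S n (h *: v + x) - S n x)) +
  (S n (h *: v + x) - S n x - h * \sum_(j < n) 'D_v (u j) x) -
  h * (series_sum (fun j => 'D_v (u j)) x - \sum_(j < n) 'D_v (u j) x) by ring.
rewrite E.
(* a tail, the difference quotient of a partial sum, a tail of derivatives *)
have T3 : `|h * (series_sum (fun j => 'D_v (u j)) x - \sum_(j < n) 'D_v (u j) x)|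
   <= e / 4 * `|h|.
  by rewrite normrM mulrC ler_wpM2r// (le_trans T2).
rewrite (le_trans (ler_normB _ _))//.
rewrite (le_trans (lerD (ler_normD _ _) (lexx _)))//.
rewrite (le_trans (lerD (lerD T1 Hd) T3))// -!mulrDl ler_wpM2r//; lra.
Qed.

Lemma series_sum_continuous u x :
  (forall j y, {for y, continuous (u j)}) -> series_bounded u ->
  {for x, continuous (series_sum u)}.
Proof.
move=> cu bu; apply/continuous_epsP => e e0.
have [J HJ] := series_sum_tail bu.
have [|n0 Hn] := @exp2N_lt (e / 6); first by rewrite divr_gt0.
pose n := maxn J n0; have en : 2 * 2 ^- n <= e / 3.
  have := Hn n (leq_maxr _ _); lra.
have cS N : {for x, continuous (fun y => \sum_(j < N) u j y)}.
  suff H : Ck_on 0 setT (fun y => \sum_(j < N) u j y) by exact: Ck_on_continuous H _.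
  by apply: Ck_on_sum => [|j]; [exact: openT|split=> // y _; exact: cu].
have /continuous_epsP /(_ (e / 3)) [|d d0 Hd] := cS n; first by rewrite divr_gt0.
exists d => // y /Hd H.
have E (a b c a1 : R) : a - b = (a - c) + (c - a1) - (b - a1) by ring.
rewrite (E _ _ (\sum_(j < n) u j y) (\sum_(j < n) u j x)).
rewrite (le_trans (ler_normB _ _))//.
rewrite (le_trans (lerD (ler_normD _ _) (lexx _)))//.
have T1 := HJ n y (leq_maxl _ _); have T2 := HJ n x (leq_maxl _ _).
rewrite (le_trans (lerD (lerD T1 H) T2))//; lra.
Qed.

Theorem series_sum_smooth u : (forall j, smooth_on setT (u j)) ->
  series_bounded u -> smooth_on setT (series_sum u).
Proof.
move=> su bu k; elim: k u su bu => [|k IH] u su bu.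
  split=> // x _; apply: series_sum_continuous => // j y.
  exact: Ck_on_continuous (su j 0%N) _.
apply: (Ck_onI (df := fun i => series_sum (fun j => 'D_(delta_mx 0 i) (u j)))).
- exact: openT.
- move=> x _; apply: series_sum_continuous => // j y.
  exact: Ck_on_continuous (su j 0%N) _.
- move=> i x _; apply: series_sum_derive => // j y.
  by have [_ /(_ i) [+ _]] := su j 1%N; apply.
- move=> i; apply: IH; last exact: series_bounded_partial.
  by move=> j; exact: smooth_on_partial.
Qed.

End series.

(** * Affine changes of variable and flat functions *)

Section precomposition.
Variables (R : realType) (V : normedModType R).
Implicit Types (f : V -> R) (x v b : V).

Lemma is_derive_lineP f x v D :
  is_derive x v f D <-> is_derive (0 : R) (1 : R) (fun h => f (h *: v + x)) D.
Proof.
split=> /is_derive_epsP H; apply/is_derive_epsP => e e0;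
    have [d d0 Hd] := H e e0; exists d => // h /Hd; rewrite scale0r add0r.
  by rewrite [h *: (1 : R)]mulr1 addr0.
by rewrite [h *: (1 : R)]mulr1 addr0.
Qed.

Lemma is_derive_outer f (G : R -> R) x v D D' :
  is_derive x v f D -> is_derive (f x) 1 G D' ->
  is_derive x v (fun y => G (f y)) (D' * D).
Proof.
move=> /is_derive_lineP df dG; apply/is_derive_lineP.
apply: (@is_derive1_comp R G (fun h : R => f (h *: v + x)) 0 D' D _ df).
by rewrite /= scale0r add0r.
Qed.

Lemma is_derive_dilate f a b x v D :
  is_derive (a *: x + b) v f D ->
  is_derive x v (fun y => f (a *: y + b)) (a * D).
Proof.
move=> /is_derive_epsP H; apply/is_derive_epsP => e e0.
have a0 : 0 < `|a| + 1 by rewrite ltr_wpDl.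
have [|d d0 Hd] := H (e / (`|a| + 1)); first by rewrite divr_gt0.
exists (d / (`|a| + 1)) => [|h hd]; first by rewrite divr_gt0.
have E : a *: (h *: v + x) + b = (a * h) *: v + (a *: x + b).
  by rewrite scalerDr scalerA addrA.
have /Hd : `|a * h| < d.
  rewrite normrM; apply: (@le_lt_trans _ _ ((`|a| + 1) * `|h|)).
    by rewrite ler_wpM2r// lerDl.
  by rewrite mulrC -ltr_pdivlMr.
rewrite E [h * (a * D)]mulrCA mulrA => /le_trans; apply.
rewrite normrM mulrA ler_wpM2r// mulrAC ler_pdivrMr// ler_wpM2l ?(ltW e0)//.
by rewrite lerDl.
Qed.

Lemma is_derive_translate f b x v D :
  is_derive (b + x) v f D -> is_derive x v (fun y => f (b + y)) D.
Proof.
move=> /is_derive_epsP H; apply/is_derive_epsP => e e0.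
have [d d0 Hd] := H e e0; exists d => // h /Hd.
by rewrite [b + (_ + _)]addrCA.
Qed.

End precomposition.

Section dilation.
Variables (R : realType) (m : nat).
Implicit Types (f : 'rV[R]_m -> R) (U W : set 'rV[R]_m).

Lemma Ck_on_dilate k U W f a b : open U -> open W ->
  (forall x, U x -> W (a *: x + b)) -> Ck_on k W f ->
  Ck_on k U (fun x => f (a *: x + b)).
Proof.
move=> oU oW UW Cf.
apply: (@Ck_on_comp _ _ _ _ U W (fun x => a *: x + b) f) => // j.
rewrite (_ : (fun x => _) = (fun x : 'rV[R]_m => a * x 0 j + b 0 j)); last first.
  by apply/funext => x; rewrite !mxE.
apply: Ck_on_add => //; last exact: Ck_on_cst.
by apply: Ck_on_mul => //; [exact: Ck_on_cst|exact: Ck_on_coord].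
Qed.

Lemma Ck_bounded_dilate k U W f a b M : open U -> open W -> 1 <= a ->
  (forall x, U x -> W (a *: x + b)) -> Ck_on k W f -> 0 <= M ->
  Ck_bounded k W M f -> Ck_bounded k U (a ^+ k * M) (fun x => f (a *: x + b)).
Proof.
move=> oU oW a1 UW + M0; have a0 : 0 <= a by rewrite (le_trans _ a1).
elim: k f => [|k IH] f [cf Cf] [bf Bf]; split=> //.
- by move=> x /UW /bf; rewrite expr0 mul1r.
- by move=> x /UW /bf /le_trans; apply; rewrite ler_peMl// exprn_ege1.
move=> i; have [df Cfi] := Cf i.
have B := Ck_bounded_scale oU a (Ck_on_dilate oU oW UW Cfi) (IH _ Cfi (Bf i)).
rewrite exprS -mulrA -{1}(ger0_norm a0).
apply: (Ck_bounded_eq oU _ B) => x Ux.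
have [_ <-//] := is_derive_dilate (derivableP (df _ (UW _ Ux))).
Qed.

End dilation.

Section flat.
Variable R : realType.
Implicit Types P : {poly R}.

(** The functions [P(1/x) exp(-1/x)], extended by [0] to [x <= 0]. They are
    all bounded, and the family is stable under differentiation. *)
Definition flat P (x : R) : R := if 0 < x then P.[x^-1] * expR (- x^-1) else 0.

Lemma flat_bounded P : exists M, forall x, `|flat P x| <= M.
Proof.
exists (\sum_(i < size P) `|P`_i| * i`!%:R) => x.
rewrite /flat; case: ifP => [x0|_]; last by rewrite normr0 sumr_ge0.
set y := x^-1; have y0 : 0 <= y by rewrite invr_ge0 ltW.
rewrite horner_coef mulr_suml (le_trans (ler_norm_sum _ _ _))//.
apply: ler_sum => i _; rewrite -mulrA normrM ler_wpM2l//.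
rewrite ger0_norm ?mulr_ge0 ?expR_ge0 ?exprn_ge0//.
rewrite expRN ler_pdivrMr ?expR_gt0//.
case: i => -[|i] _ /=; first by rewrite fact0 expr0 mul1r -[leLHS]expR0 ler_expR.
have := expR_ge1Dxn i y0; set E := expR y => H.
have : y ^+ i.+1 / i.+1`!%:R <= E by rewrite (le_trans _ H)// lerDr.
by rewrite ler_pdivrMr ?ltr0n ?fact_gt0// mulrC.
Qed.

Lemma flatMX P x : flat P x = x * flat ('X * P) x.
Proof.
rewrite /flat; case: ifP => x0; last by rewrite mulr0.
by rewrite hornerM hornerX !mulrA divff ?mul1r// gt_eqF.
Qed.

(** At [0] the difference quotient is [h * flat ('X^2 * P) h], by [flatMX]. *)
Lemma is_derive_flat P (x : R) :
  is_derive x (1 : R) (flat P) (flat ('X^2 * (P - P^`())) x).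
Proof.
have [x0|x0|->] := ltgtP x 0.
- rewrite [X in is_derive _ _ _ X](_ : _ = 0); last first.
    by rewrite /flat ltNge (ltW x0).
  apply: (near_eq_is_derive (f := fun=> 0)).
  near=> y; rewrite /flat ifF//; apply/negbTE; rewrite -leNgt ltW//.
  by near: y; exact: lt_nbhsl.
- rewrite [X in is_derive _ _ _ X]/flat x0.
  have near_flat : \near x, P.[x^-1] * expR (- x^-1) = flat P x.
    near=> y; rewrite /flat ifT//.
    by near: y; exact: lt_nbhsr.
  apply: near_eq_is_derive near_flat _.
  have dV : is_derive x (1 : R) (fun y : R => y^-1) (- x ^- 2).
    have := @is_deriveV R id x 1 1 (lt0r_neq0 x0) (is_derive_id _ _).
    by rewrite /GRing.scale/= mulr1.
  have d1 := @is_derive1_comp R (horner P) (fun y => y^-1) x _ _ (is_derive_poly P x^-1) dV.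
  have d2 := @is_derive1_comp R expR (fun y => - y^-1) x _ _
    (is_derive_expR _) (is_deriveN dV).
  apply: (is_derive_eq (is_deriveM d1 d2)).
  rewrite /GRing.scale/= hornerM hornerXn hornerD hornerN exprVn; ring.
- rewrite [X in is_derive _ _ _ X]/flat ltxx; apply/is_derive_epsP => e e0.
  have [M HM] := flat_bounded ('X * ('X * P)).
  have M0 : 0 <= M by rewrite (le_trans _ (HM 0)).
  have M1 : 0 < M + 1 by rewrite ltr_wpDl.
  exists (e / (M + 1)) => [|h hd]; first by rewrite divr_gt0.
  rewrite [h *: (1 : R)]mulr1 addr0 mulr0 subr0 {2}/flat ltxx subr0.
  rewrite flatMX flatMX !normrM mulrCA mulrC ler_wpM2r//.
  rewrite (le_trans (ler_wpM2l (normr_ge0 _) (HM h)))//.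
  rewrite ltr_pdivlMr// in hd; rewrite (le_trans _ (ltW hd))// ler_wpM2l// lerDl//.
Unshelve. all: by end_near. Qed.

Section flat_comp.
Variables (m : nat) (U : set 'rV[R]_m) (p : 'rV[R]_m -> R).
Hypothesis oU : open U.

Lemma is_derive_flat_comp P i x : smooth_on U p -> U x ->
  is_derive x (delta_mx 0 i) (fun y => flat P (p y))
    (flat ('X^2 * (P - P^`())) (p x) * 'D_(delta_mx 0 i) p x).
Proof.
move=> sp Ux; apply: is_derive_outer; last exact: is_derive_flat.
by apply: derivableP; have [_ /(_ i) [+ _]] := sp 1%N; apply.
Qed.

Lemma flat_comp_continuous P x : smooth_on U p -> U x ->
  {for x, continuous (fun y => flat P (p y))}.
Proof.
move=> sp Ux; apply: continuous_comp; first exact: Ck_on_continuous (sp 0%N) Ux.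
by apply/differentiable_continuous/derivable1_diffP; have [] := is_derive_flat P (p x).
Qed.

Lemma smooth_on_flat_comp P : smooth_on U p ->
  smooth_on U (fun x => flat P (p x)).
Proof.
move=> sp k; elim: k P => [|k IH] P.
  by split=> // x; exact: flat_comp_continuous.
apply: (Ck_onI (df := fun i x =>
  flat ('X^2 * (P - P^`())) (p x) * 'D_(delta_mx 0 i) p x)) => //.
- by move=> x; exact: flat_comp_continuous.
- by move=> i x; exact: is_derive_flat_comp.
- move=> i; apply: Ck_on_mul => //; exact: smooth_on_partial.
Qed.

Lemma bounded_smooth_flat_comp P : smooth_on U p ->
  (forall i, bounded_smooth U ('D_(delta_mx 0 i) p)) ->
  bounded_smooth U (fun x => flat P (p x)).
Proof.
move=> sp bp; split=> [|k]; first exact: smooth_on_flat_comp.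
have b0 Q : exists M, forall x, U x -> `|flat Q (p x)| <= M.
  by have [M HM] := flat_bounded Q; exists M.
elim: k P => [|k IH] P; first by have [M HM] := b0 P; exists M.
apply: Ck_boundedS => // i.
have [M HM] := IH ('X^2 * (P - P^`())); have [N HN] := (bp i).2 k.
exists (2 ^+ k * (`|M| * `|N|)).
apply: (Ck_bounded_eq (f := fun x =>
  flat ('X^2 * (P - P^`())) (p x) * 'D_(delta_mx 0 i) p x)) => //.
  by move=> x Ux; have [_ ->] := is_derive_flat_comp P i sp Ux.
apply: Ck_bounded_mul => //.
- exact: smooth_on_flat_comp.
- exact: (bp i).1.
- exact: Ck_boundedW (leqnn k) (ler_norm M) HM.
- exact: Ck_boundedW (leqnn k) (ler_norm N) HN.
Qed.

End flat_comp.
End flat.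

(** * Bumps and cutoffs *)

Section step.
Variable R : realType.

(** Only the derivatives of [p] are required to be bounded, so that [p] may be
    a coordinate. *)
Definition smooth_compose (S : R -> R) := forall m (U : set 'rV[R]_m) p,
  open U -> smooth_on U p ->
  (forall i, bounded_smooth U ('D_(delta_mx 0 i) p)) ->
  bounded_smooth U (fun x => S (p x)).

Lemma bounded_smooth_affine m (U : set 'rV[R]_m) (a c : R) p i : open U ->
  smooth_on U p -> bounded_smooth U ('D_(delta_mx 0 i) p) ->
  bounded_smooth U ('D_(delta_mx 0 i) (fun x => a * p x + c)).
Proof.
move=> oU sp bp.
apply: (bounded_smooth_eq oU _ (bounded_smooth_mul oU (bounded_smooth_cst oU a) bp)).
move=> x Ux; have [_ /(_ i) [/(_ x Ux) dp _]] := sp 1%N.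
have dap : is_derive x (delta_mx 0 i) (fun x => a * p x + c)
    (a *: 'D_(delta_mx 0 i) p x + 0).
  exact: is_deriveD (is_deriveZ a (derivableP dp)) (is_derive_cst c _ _).
by have [_ ->] := dap; rewrite addr0.
Qed.

Lemma smooth_on_affine m (U : set 'rV[R]_m) (a c : R) p : open U ->
  smooth_on U p -> smooth_on U (fun x => a * p x + c).
Proof.
move=> oU sp; apply: smooth_on_add => //; last exact: smooth_on_cst.
by apply: smooth_on_mul => //; exact: smooth_on_cst.
Qed.

(** With [G x = exp(-1/x)] extended by [0], the quotient of
    [G (G 1 - G (1 - t))] by its constant value for [1 <= t] is a smooth step:
    [G 1 - G (1 - t)] is nonpositive for [t <= 0]. It is built from [G] by
    compositions with affine maps, which the theory of [flat] covers. *)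
Lemma smooth_step_exists : exists S : R -> R,
  [/\ forall t, t <= 0 -> S t = 0, forall t, 1 <= t -> S t = 1,
      {homo S : s t / s <= t} & smooth_compose S].
Proof.
pose G : R -> R := flat 1.
have G0 x : x <= 0 -> G x = 0 by rewrite /G /flat ltNge => ->.
have G_gt0 x : 0 < x -> 0 < G x.
  by move=> x0; rewrite /G /flat x0 hornerC mul1r expR_gt0.
have G_homo x y : x <= y -> G x <= G y.
  move=> xy; have [x0|x0] := leP x 0.
    rewrite G0//; have [/G0 ->//|/G_gt0/ltW//] := leP y 0.
  have y0 : 0 < y by exact: lt_le_trans xy.
  by rewrite /G /flat x0 y0 !hornerC !mul1r ler_expR lerN2 lef_pV2.
have cG : smooth_compose G.
  by move=> m U p oU sp bp; exact: bounded_smooth_flat_comp.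
clearbody G.
have GG0 : 0 < G (G 1) by rewrite !G_gt0.
exists (fun t => (G (G 1))^-1 * G (-1 * G (-1 * t + 1) + G 1)); split.
- move=> t t0; rewrite [G (_ + G 1)]G0 ?mulr0// mulN1r addrC subr_le0.
  by apply: (G_homo); rewrite mulN1r; lra.
- move=> t t1; rewrite [G (-1 * t + 1)]G0; last by rewrite mulN1r; lra.
  by rewrite mulr0 add0r mulVf// gt_eqF.
- move=> s t st; rewrite ler_pM2l ?invr_gt0//; apply: (G_homo).
  by rewrite !mulN1r lerD2r lerN2; apply: (G_homo); rewrite lerD2r lerN2.
- move=> m U p oU sp bp.
  have b1 := cG _ _ _ oU (smooth_on_affine (-1) 1 oU sp)
    (fun i => bounded_smooth_affine (-1) 1 oU sp (bp i)).
  have b2 := cG _ _ _ oU (smooth_on_affine (-1) (G 1) oU b1.1)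
    (fun i => bounded_smooth_affine (-1) (G 1) oU b1.1 (bounded_smooth_partial i b1)).
  exact: (bounded_smooth_mul oU (bounded_smooth_cst oU (G (G 1))^-1) b2).
Qed.

(** Differences [S (t + 1) - S t] of a step: sums of integer translates
    telescope, so that they form a partition of unity. *)
Lemma bump_exists : exists b : R -> R,
  [/\ forall t, 1 <= `|t| -> b t = 0, b 0 = 1, forall t, 0 <= b t <= 1,
      forall n t, 0 <= t -> t + 1 <= n%:R -> \sum_(i < n) b (t - i%:R) = 1 &
      forall m (j : 'I_m), bounded_smooth setT (fun x : 'rV[R]_m => b (x 0 j))].
Proof.
have [S [S0 S1 S_homo cS]] := smooth_step_exists.
exists (fun t => S (t + 1) + -1 * S t); split.
- move=> t; rewrite mulN1r; have [t0|t0] := leP 0 t.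
    by rewrite (ger0_norm t0) => t1; rewrite !S1 ?subrr// ler_wpDr.
  by rewrite (ltr0_norm t0) => t1; rewrite !S0 ?subrr//; lra.
- by rewrite add0r S1// S0// mulr0 addr0.
- move=> t; rewrite mulN1r subr_ge0 S_homo ?lerDl//=.
  rewrite lerBlDr; apply: (@le_trans _ _ 1).
    have [t1|t1] := leP 1 (t + 1); first by rewrite S1.
    by rewrite -[leRHS](S1 1)// S_homo// ltW.
  rewrite lerDl; have [t0|t0] := leP t 0; first by rewrite S0.
  by rewrite -(S0 0)// S_homo// ltW.
- move=> n t t0 tn.
  have -> : \sum_(i < n) (S (t - i%:R + 1) + -1 * S (t - i%:R)) =
      S (t + 1) - S (t + 1 - n%:R).
    elim: n {tn} => [|n IH]; first by rewrite big_ord0 subr0 subrr.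
    rewrite big_ord_recr/= IH -[n.+1]addn1 natrD mulN1r.
    have -> : t - n%:R + 1 = t + 1 - n%:R by ring.
    have -> : t - n%:R = t + 1 - (n%:R + 1) by ring.
    by rewrite addrA subrK.
  by rewrite S1 ?lerDr// S0 ?subr0// subr_le0.
- move=> m j; have oT := @openT 'rV[R]_m.
  have bc i : bounded_smooth setT ('D_(delta_mx 0 i) (fun x : 'rV[R]_m => x 0 j)).
    apply: (bounded_smooth_eq oT _ (bounded_smooth_cst oT (i == j)%:R)) => x _.
    by have [_ ->] := is_derive_coord i j x.
  have sc : smooth_on setT (fun x : 'rV[R]_m => x 0 j) by move=> k; exact: Ck_on_coord.
  have b0 := cS _ _ _ oT sc bc.
  have b1 := cS _ _ _ oT (smooth_on_affine 1 1 oT sc)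
    (fun i => bounded_smooth_affine 1 1 oT sc (bc i)).
  have b2 := bounded_smooth_add oT b1
     (bounded_smooth_mul oT (bounded_smooth_cst oT (-1)) b0).
  by apply: (bounded_smooth_eq oT _ b2) => x _; rewrite mul1r.
Qed.

End step.

Section cutoff.
Variables (R : realType) (d : nat).

(** Sum of those bumps of a grid of mesh [e] that do not vanish on [K]. The
    grid has at most a multiple of [e ^- d] points, so that adding up the bounds
    of all bumps still gives a bound polynomial in [1 / e]. *)
Lemma cutoff (K : set 'rV[R]_d) (A : R) : (forall x, K x -> `|x| <= A) ->
  exists C : nat -> R, (forall k, 0 <= C k) /\
  forall e : R, 0 < e -> e <= 1 -> exists chi : 'rV[R]_d -> R,
  [/\ smooth_on setT chi,
     forall k, Ck_bounded k setT (C k * e ^- (k + d)) chi,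
     forall x, K x -> chi x = 1 &
     forall x, (forall y, K y -> 2 * e <= `|x - y|) -> chi x = 0].
Proof.
move=> KA'; wlog [A0 KA] : A KA' / 0 <= A /\ forall x, K x -> `|x| <= A.
  move=> H; have := H `|A|; apply.
    by move=> x /KA' /le_trans; apply; exact: ler_norm.
  by split=> // x /KA' /le_trans; apply; exact: ler_norm.
have oT := @openT 'rV[R]_d.
have [bump [bump_supp _ _ sum_bump bounded_smooth_bump]] := bump_exists R.
pose Phi (z : 'rV[R]_d) : R := \prod_j bump (z 0 j).
have bPhi : bounded_smooth setT Phi.
  by apply: bounded_smooth_prod => // j; exact: bounded_smooth_bump.
have /choice [M HM] := bPhi.2.
exists (fun k => (2 * A + 3) ^+ d * `|M k|); split.
  by move=> k; rewrite mulr_ge0// exprn_ge0//; lra.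
move=> e e0 e1.
(* The coordinates of [K], shifted by [A] and divided by [e], lie between [0]
   and [n - 1]. *)
pose n := (Num.trunc ((2 * A) / e)).+2.
have Ae : 0 <= 2 * A / e by rewrite divr_ge0 ?(ltW e0)// mulr_ge0.
have n1 : 2 * A / e + 1 <= n%:R.
  by have := truncnS_gt (2 * A / e); rewrite /n -addn1 natrD; lra.
have n2 : n%:R <= (2 * A + 3) / e.
  have := Ae; rewrite -truncn_le; rewrite /n -addn2 natrD => H.
  have : 1 <= e^-1 by rewrite invf_ge1.
  by move: H; rewrite !mulrDl; lra.
pose b (p : {ffun 'I_d -> 'I_n}) : 'rV[R]_d := \row_j (A / e - (p j)%:R).
pose phi p x := Phi (e^-1 *: x + b p).
pose S := [pred p | `[< exists2 y, K y & phi p y != 0 >]].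
have e'1 : 1 <= e^-1 by rewrite invf_ge1.
exists (fun x => \sum_(p in S) phi p x).
have sphi p : smooth_on setT (phi p).
  move=> k; apply: (@Ck_on_dilate _ _ _ _ setT) => //; exact: bPhi.1.
split.
- by move=> k; apply: Ck_on_sum => // p; exact: sphi.
- move=> k.
  have B p : Ck_bounded k setT (e^-1 ^+ k * `|M k|) (phi p).
    apply: (@Ck_bounded_dilate _ _ _ _ setT) => //; first exact: bPhi.1.
    exact: Ck_boundedW (leqnn k) (ler_norm _) (HM k).
  have B0 : 0 <= e^-1 ^+ k * `|M k| by rewrite mulr_ge0// exprn_ge0// invr_ge0 ltW.
  apply: Ck_boundedW (Ck_bounded_sum oT (index_enum _) (fun p => p \in S) B0
    (fun p => sphi p k) B) => //.
  rewrite (_ : size _ = n ^ d)%N; last first.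
    rewrite -sum1_size -[RHS](_ : #|{ffun 'I_d -> 'I_n}| = _).
      by rewrite -sum1_card; apply: eq_bigl => p; rewrite inE.
    by rewrite card_ffun !card_ord.
  rewrite natrX exprVn exprD invfM.
  rewrite [leRHS](_ : _ = ((2 * A + 3) / e) ^+ d * (e ^- k * `|M k|)); last first.
    by rewrite expr_div_n; ring.
  rewrite ler_wpM2r ?mulr_ge0 ?invr_ge0 ?exprn_ge0 ?(ltW e0)//.
  by apply: lerXn2r => //; rewrite nnegrE ?ler0n// (le_trans _ n2).
- move=> x Kx.
  have -> : \sum_(p in S) phi p x = \sum_p phi p x.
    rewrite big_mkcond/=; apply: eq_bigr => p _; case: ifP => //.
    move=> /negbT; rewrite inE => /asboolPn H.
    by apply/esym/eqP/negP => /negP H'; apply: H; exists x.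
  pose t j := (x 0 j + A) / e.
  rewrite (eq_bigr (fun p : {ffun 'I_d -> 'I_n} =>
    \prod_j bump (t j - (p j)%:R))); last first.
    move=> p _; apply: eq_bigr => j _; congr bump; rewrite !mxE /t; ring.
  rewrite -(bigA_distr_bigA (fun j (i : 'I_n) => bump (t j - i%:R))).
  rewrite big1// => j _; apply: sum_bump.
    have := le_trans (coord_norm_le x j) (KA x Kx); rewrite ler_norml => /andP[xA _].
    by rewrite divr_ge0 ?(ltW e0)//; lra.
  apply: le_trans n1; rewrite lerD2r ler_pM2r ?invr_gt0//.
  have := le_trans (coord_norm_le x j) (KA x Kx); rewrite ler_norml => /andP[_ xA].
  lra.
- move=> x xK; apply: big1 => p pS.
  have /asboolP [y Ky py] : `[< exists2 y, K y & phi p y != 0 >] by move: pS; rewrite inE.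
  apply/eqP/negP => /negP px; have := xK y Ky; rewrite leNgt => /negP; apply.
  apply/row_norm_lt => [|j]; first by rewrite mulr_gt0.
  have near_grid z : phi p z != 0 -> `|e^-1 * z 0 j + b p 0 j| < 1.
    move=> pz; rewrite ltNge; apply/negP => H; move: pz.
    rewrite /phi /Phi (bigD1 j)//= bump_supp ?mul0r ?eqxx//.
    by rewrite mxE [(e^-1 *: z) _ _]mxE.
  have := near_grid _ px; have := near_grid _ py; rewrite !ltr_norml.
  move=> /andP[Hy1 Hy2] /andP[Hx1 Hx2]; rewrite !mxE.
  have -> : x 0 j - y 0 j = e * ((e^-1 * x 0 j + b p 0 j) - (e^-1 * y 0 j + b p 0 j)).
    by field; rewrite gt_eqF.
  rewrite -ltr_norml normrM (gtr0_norm e0) mulrC ltr_pM2r// ltr_norml.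
  by apply/andP; split; lra.
Qed.

End cutoff.

(** * Extrapolation in the shift operator *)

Section combination.
Variable R : realType.
Implicit Types (q r P : {poly R}) (a : nat -> R).

(** Evaluation at the sequence [a] of a polynomial in the shift operator. *)
Definition shift_eval q a := \sum_(i < size q) q`_i * a i.

Lemma shift_eval_widen q a n : (size q <= n)%N ->
  shift_eval q a = \sum_(i < n) q`_i * a i.
Proof.
move=> qn; rewrite /shift_eval (big_ord_widen n (fun i => q`_i * a i) qn).
rewrite [RHS](bigID (fun i : 'I_n => (i < size q)%N))/= [X in _ + X]big1 ?addr0//.
by move=> i; rewrite -leqNgt => qi; rewrite nth_default ?mul0r.
Qed.

Lemma shift_evalD q r a :
  shift_eval (q + r) a = shift_eval q a + shift_eval r a.
Proof.
pose n := maxn (size q) (size r).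
rewrite (@shift_eval_widen _ _ n) ?size_polyD// (@shift_eval_widen q _ n) ?leq_maxl//.
rewrite (@shift_eval_widen r _ n) ?leq_maxr// -big_split/=.
by apply: eq_bigr => i _; rewrite coefD mulrDl.
Qed.

Lemma shift_evalZ c q a : shift_eval (c *: q) a = c * shift_eval q a.
Proof.
rewrite (@shift_eval_widen _ _ (size q)) ?size_scale_leq// mulr_sumr.
by apply: eq_bigr => i _; rewrite coefZ mulrA.
Qed.

Lemma shift_evalB q r a :
  shift_eval (q - r) a = shift_eval q a - shift_eval r a.
Proof. by rewrite shift_evalD -scaleN1r shift_evalZ mulN1r. Qed.

Lemma shift_evalMX q a : shift_eval (q * 'X) a = shift_eval q (fun i => a i.+1).
Proof.
rewrite (@shift_eval_widen _ _ (size q).+1); last first.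
  have [->|q0] := eqVneq q 0; first by rewrite mul0r size_poly0.
  by rewrite size_mulX.
rewrite big_ord_recl coefMX eqxx mul0r add0r; apply: eq_bigr => i _.
by rewrite coefMX.
Qed.

Lemma shift_evalC c a : shift_eval c%:P a = c * a 0%N.
Proof. by rewrite (@shift_eval_widen _ _ 1) ?size_polyC_leq1// big_ord1 coefC eqxx. Qed.

Lemma shift_eval_comp2 q a :
  shift_eval (q \Po 'X^2) a = shift_eval q (fun i => a i.*2).
Proof.
elim/poly_ind: q a => [|q c IH] a; first by rewrite comp_poly0 -polyC0 !shift_evalC !mul0r.
rewrite comp_polyD comp_polyM comp_polyX comp_polyC !shift_evalD !shift_evalC.
congr (_ + _); rewrite expr2 mulrA !shift_evalMX IH.
by [].
Qed.

(** Multiplying by [r] costs only a constant depending on [r]. *)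
Lemma shift_evalM_bound P r : exists C N, 0 <= C /\ forall a B,
  (forall k, (k <= N)%N -> `|shift_eval P (fun i => a (i + k)%N)| <= B) ->
  `|shift_eval (P * r) a| <= C * B.
Proof.
elim/poly_ind: r => [|r c [C [N [C0 IH]]]].
  exists 0, 0%N; split=> // a B _.
  by rewrite mulr0 -polyC0 shift_evalC !mul0r normr0.
exists (C + `|c|), N.+1; split=> [|a B H]; first by rewrite addr_ge0.
rewrite mulrDr mulrA shift_evalD shift_evalMX [P * c%:P]mulrC mul_polyC shift_evalZ mulrDl.
rewrite (le_trans (ler_normD _ _))// lerD//.
  apply: IH => k kN; have := H k.+1 kN.
  rewrite (_ : (fun i => a (i + k).+1) = (fun i => a (i + k.+1)%N))//.
  by apply/funext => i; rewrite addnS.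
rewrite normrM ler_wpM2l//; have := H 0%N isT.
by rewrite (_ : (fun i => a (i + 0)%N) = a)//; apply/funext => i; rewrite addn0.
Qed.

(** Reading ['X] as a shift, [extrapolation m] recovers the value of a sequence
    at [0] from the next [m] values, up to its difference of order [m]. *)
Definition extrapolation m : {poly R} := \sum_(i < m) (1 - 'X) ^+ i.

Lemma extrapolationX m : extrapolation m * 'X = 1 - (1 - 'X) ^+ m.
Proof.
have := subrX1 (1 - 'X : {poly R}) m; rewrite -/(extrapolation m) => E.
by rewrite -[RHS]opprB E addrAC subrr add0r mulNr opprK mulrC.
Qed.

(** Composition with ['X^2] doubles the mesh. Thus halving the mesh and raising
    the order by [b] changes the extrapolation by a difference of order [m]. *)
Lemma extrapolation_refine m b : exists r,
  extrapolation (m + b) - (extrapolation m \Po 'X^2) * 'X = (1 - 'X) ^+ m * r.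
Proof.
exists (\sum_(i < m) (1 + 'X) ^+ i + extrapolation b).
apply: (@mulIf _ 'X); first by rewrite polyX_eq0.
have E1 : (extrapolation m \Po 'X^2) * 'X * 'X = 1 - (1 - 'X^2) ^+ m.
  rewrite -mulrA -expr2 -[in X in _ * X](comp_polyX 'X^2) -comp_polyM.
  by rewrite extrapolationX comp_polyB rmorphXn/= comp_polyB comp_polyX -polyC1 comp_polyC.
have E2 : (\sum_(i < m) (1 + 'X) ^+ i) * 'X = (1 + 'X) ^+ m - 1 :> {poly R}.
  by rewrite subrX1 [1 + 'X - 1]addrAC subrr add0r mulrC.
have E3 : (1 - 'X^2) ^+ m = (1 - 'X) ^+ m * (1 + 'X) ^+ m :> {poly R}.
  by rewrite -exprMn; congr (_ ^+ _); ring.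
rewrite mulrBl E1 extrapolationX -mulrA mulrDl E2 extrapolationX E3 exprD; ring.
Qed.

End combination.

(** * Finite differences *)

Section directional.
Variables (R : realType) (d : nat) (U : set 'rV[R]_d) (w : 'rV[R]_d).
Hypothesis oU : open U.
Implicit Types u : 'rV[R]_d -> R.

(** The derivative along [w] as a combination of partial derivatives. *)
Lemma is_derive_dir u x : smooth_on U u -> U x ->
  is_derive x w u (\sum_j 'D_(delta_mx 0 j) u x * w 0 j).
Proof.
move=> su Ux; have [_ H1] := su 1%N.
have dc j : is_derive x w (fun y : 'rV[R]_d => y 0 j) (w 0 j).
  apply/is_derive_epsP => e e0; exists 1 => // h _.
  by rewrite !mxE addrK subrr normr0 mulr_ge0// ltW.
apply: (is_derive_comp (p := id) dc).
apply: (C1_frechet oU Ux).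
  by move=> j y Uy; have [+ _] := H1 j; apply.
by move=> j; have [_ [Cj _]] := H1 j; exact: Cj.
Qed.

Lemma bounded_smooth_dir u : bounded_smooth U u -> bounded_smooth U ('D_w u).
Proof.
move=> bu; apply: (@bounded_smooth_eq _ _ _ oU
    (fun x => \sum_j 'D_(delta_mx 0 j) u x * w 0 j)).
  by move=> x Ux; have [_ ->] := is_derive_dir bu.1 Ux.
apply: bounded_smooth_sum => // j; apply: bounded_smooth_mul => //.
  exact: bounded_smooth_partial.
exact: bounded_smooth_cst.
Qed.

Lemma size_diff_poly m : (size ((1 - 'X : {poly R}) ^+ m) <= m.+1)%N.
Proof.
apply: leq_trans (size_poly_exp_leq _ _) _.
by rewrite -opprB size_polyN -polyC1 size_XsubC mul1n.
Qed.

(** Each factor [1 - 'X] gives rise to one derivative along [w] and to one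
    factor [e], by the mean value theorem. *)
Lemma finite_difference_bound m u : bounded_smooth U u ->
  exists B, 0 <= B /\ forall e x, 0 <= e ->
   (forall s, 0 <= s <= m%:R * e -> U (s *: w + x)) ->
   `|shift_eval ((1 - 'X) ^+ m) (fun i => u ((i%:R * e) *: w + x))| <= e ^+ m * B.
Proof.
elim: m u => [|m IH] u bu.
  have [M HM] := bu.2 0%N; exists `|M|; split=> // e x e0 Ux.
  rewrite expr0 -polyC1 shift_evalC !mul1r mul0r scale0r add0r.
  rewrite (le_trans _ (ler_norm M))// (Ck_bounded0 HM)//.
  by rewrite -[x]add0r -(scale0r w); apply: Ux; rewrite mul0r lexx.
have [B [B0 HB]] := IH _ (bounded_smooth_dir bu).
exists B; split=> // e x e0 Ux.
rewrite exprSr mulrBr mulr1 shift_evalB shift_evalMX.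
pose v (y : 'rV[R]_d) := shift_eval ((1 - 'X) ^+ m) (fun i => u ((i%:R * e) *: w + y)).
have -> : shift_eval ((1 - 'X) ^+ m) (fun i => u ((i.+1%:R * e) *: w + x)) = v (e *: w + x).
  apply: eq_bigr => i _; congr (_ * u _).
  by rewrite addrA -scalerDl -[i.+1]addn1 natrD mulrDl mul1r.
rewrite -[X in X - _]/(v x) distrC.
have dv (s : R) : 0 <= s <= 1 ->
   is_derive ((s * e) *: w + x) w v
    (shift_eval ((1 - 'X) ^+ m)
      (fun i => 'D_w u ((i%:R * e) *: w + ((s * e) *: w + x)))).
  move=> /andP[s0 s1].
  apply: (@is_derive_sumn R d
    (fun i y => ((1 - 'X) ^+ m)`_i * u ((i%:R * e) *: w + y))
    (fun i => ((1 - 'X) ^+ m)`_i * 'D_w u ((i%:R * e) *: w + ((s * e) *: w + x)))) => i im.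
  have Ui : U ((i%:R * e) *: w + ((s * e) *: w + x)).
    rewrite addrA -scalerDl; apply: Ux.
    rewrite -mulrDl mulr_ge0 ?addr_ge0//= ler_wpM2r// -addn1 natrD lerD//.
    by rewrite ler_nat -ltnS (leq_trans im)// size_diff_poly.
  have [du _] := is_derive_dir bu.1 Ui.
  exact: (is_deriveZ _ (is_derive_translate (derivableP du))).
have [|s s01 ->] := @MVT_line R _ v x w e.
  by move=> s /dv [].
have [_ ->] := dv s s01.
rewrite normrM (ger0_norm e0) exprS -mulrA ler_wpM2l//.
apply: HB => // s' /andP[s'0 s'1]; rewrite addrA -scalerDl; apply: Ux.
have /andP[s0 s1] := s01.
rewrite addr_ge0 ?mulr_ge0//= -addn1 natrD mulrDl mul1r lerD//.
by rewrite -[leRHS]mul1r ler_wpM2r.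
Qed.

(** The translations start at [e *: w]: [x] itself may be outside [U]. *)
Definition shift_sum q (e : R) u (x : 'rV[R]_d) :=
  shift_eval q (fun i => u ((i.+1%:R * e) *: w + x)).

Lemma shift_sum_bound m r : exists N : nat, forall u, bounded_smooth U u ->
  exists C, 0 <= C /\ forall e x, 0 <= e ->
   (forall s, e <= s <= N%:R * e -> U (s *: w + x)) ->
   `|shift_sum ((1 - 'X) ^+ m * r) e u x| <= C * e ^+ m.
Proof.
have [C [N [C0 HC]]] := shift_evalM_bound ((1 - 'X) ^+ m) r.
exists (m + N.+1)%N => u bu; have [B [B0 HB]] := finite_difference_bound m bu.
exists (C * B); split=> [|e x e0 Ux]; first exact: mulr_ge0.
rewrite -mulrA [B * _]mulrC; apply: HC => k kN.
rewrite (_ : (fun i => _) =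
  (fun i => u ((i%:R * e) *: w + ((k.+1%:R * e) *: w + x)))); last first.
  apply/funext => i; congr u.
  by rewrite addrA -scalerDl -mulrDl -natrD addnS.
apply: HB => // s /andP[s0 s1]; rewrite addrA -scalerDl; apply: Ux.
have k1 : e <= k.+1%:R * e by rewrite ler_peMl// ler1n.
apply/andP; split; first by rewrite (le_trans k1)// lerDr.
by rewrite natrD mulrDl lerD// ler_wpM2r// ler_nat.
Qed.

Variables (K : set 'rV[R]_d) (rho : R).
Hypothesis rho0 : 0 < rho.
(** Every point within [t * rho] of [K] enters [U] when moved by [t *: w]. *)
Hypothesis KU : forall (y : 'rV[R]_d) (t : R) (z : 'rV[R]_d),
  K y -> 0 < t <= 1 -> `|z - y| < t * rho -> U (t *: w + z).

Definition thickening (e : R) : set 'rV[R]_d :=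
  [set x | exists2 y, K y & `|x - y| < e * rho].

Lemma open_thickening e : open (thickening e).
Proof.
rewrite openE => x [y Ky xy]; apply/nbhs_ballP.
exists (e * rho - `|x - y|); first by rewrite /= subr_gt0.
move=> z; rewrite -ball_normE/= => xz; exists y => //.
rewrite -(subrKA x) (le_lt_trans (ler_normD _ _))// -ltrBrDr.
by rewrite distrC.
Qed.

Lemma thickeningU (e s : R) x : 0 < e -> e <= s <= 1 -> thickening e x -> U (s *: w + x).
Proof.
move=> e0 /andP[es s1] [y Ky xy]; apply: (KU Ky).
  by rewrite (lt_le_trans e0 es).
by rewrite (lt_le_trans xy)// ler_wpM2r// ltW.
Qed.

Lemma shift_sum_smooth (q : {poly R}) (e : R) u : bounded_smooth U u -> 0 < e ->
  (size q)%:R * e <= 1 -> smooth_on (thickening e) (shift_sum q e u).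
Proof.
move=> bu e0 qe k; have oT := @open_thickening e.
apply: Ck_on_sum => // j; apply: Ck_on_mul => //; first exact: Ck_on_cst.
have := @Ck_on_dilate _ _ k (thickening e) U u 1 ((j.+1%:R * e) *: w) oT oU.
under eq_fun do rewrite scale1r addrC; apply; last exact: bu.1.
move=> x Tx; rewrite scale1r addrC; apply: thickeningU Tx => //.
rewrite ler_peMl ?ler1n ?(ltW e0)//= (le_trans _ qe)// ler_wpM2r ?(ltW e0)//.
by rewrite ler_nat.
Qed.

Lemma shift_sum_partial (q : {poly R}) (e : R) u i x : bounded_smooth U u -> 0 < e ->
  (size q)%:R * e <= 1 -> thickening e x ->
  'D_(delta_mx 0 i) (shift_sum q e u) x =
  shift_sum q e ('D_(delta_mx 0 i) u) x.
Proof.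
move=> bu e0 qe Tx.
have [_ ->//] : is_derive x (delta_mx 0 i) (shift_sum q e u)
    (shift_sum q e ('D_(delta_mx 0 i) u) x).
apply: (@is_derive_sumn R d (fun j y => q`_j * u ((j.+1%:R * e) *: w + y))
  (fun j => q`_j * 'D_(delta_mx 0 i) u ((j.+1%:R * e) *: w + x))) => j jq.
have Uj : U ((j.+1%:R * e) *: w + x).
  apply: thickeningU Tx => //.
  rewrite ler_peMl ?ler1n ?(ltW e0)//= (le_trans _ qe)// ler_wpM2r ?(ltW e0)//.
  by rewrite ler_nat.
have du : derivable u ((j.+1%:R * e) *: w + x) (delta_mx 0 i).
  by have [_ /(_ i) [+ _]] := bu.1 1%N; apply.
exact: (is_deriveZ _ (is_derive_translate (derivableP du))).
Qed.

(** Partial derivatives commute with translations, so that the bound for [u]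
    applies to each derivative of [u]. *)
Lemma shift_sum_Ck_bounded m r : exists N : nat, forall k u,
  bounded_smooth U u -> exists C, 0 <= C /\ forall e, 0 < e -> N%:R * e <= 1 ->
    Ck_bounded k (thickening e) (C * e ^+ m) (shift_sum ((1 - 'X) ^+ m * r) e u).
Proof.
have [N HN] := shift_sum_bound m r; set q := _ * r in HN *.
exists (N + size q)%N => k; elim: k => [|k IH] u bu.
  have [C [C0 HC]] := HN u bu; exists C; split=> // e e0 Ne; split=> // x Tx.
  apply: HC => [|s /andP[es s1]]; first exact: ltW.
  apply: thickeningU Tx => //; rewrite es (le_trans s1)// (le_trans _ Ne)//.
  by rewrite ler_wpM2r ?(ltW e0)// ler_nat leq_addr.
have [C [C0 HC]] := HN u bu.
have /choice [C' HC'] : forall i, exists C, 0 <= C /\ forall e, 0 < e ->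
   (N + size q)%N%:R * e <= 1 -> Ck_bounded k (thickening e) (C * e ^+ m)
     (shift_sum q e ('D_(delta_mx 0 i) u)).
  by move=> i; apply: IH; exact: bounded_smooth_partial.
have C'0 i : 0 <= C' i by have [] := HC' i.
exists (C + \sum_i C' i); split; first by rewrite addr_ge0// sumr_ge0.
move=> e e0 Ne; split.
  move=> x Tx; apply: (@le_trans _ _ (C * e ^+ m)); last first.
    by rewrite ler_wpM2r ?exprn_ge0 ?(ltW e0)// lerDl sumr_ge0.
  apply: HC => [|s /andP[es s1]]; first exact: ltW.
  apply: thickeningU Tx => //; rewrite es (le_trans s1)// (le_trans _ Ne)//.
  by rewrite ler_wpM2r ?(ltW e0)// ler_nat leq_addr.
move=> i; have [_ /(_ e e0 Ne) B] := HC' i.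
apply: (@Ck_bounded_eq _ _ k (thickening e) _ (shift_sum q e ('D_(delta_mx 0 i) u))).
- exact: open_thickening.
- move=> x Tx; rewrite shift_sum_partial// (le_trans _ Ne)//.
  by rewrite ler_wpM2r ?(ltW e0)// ler_nat leq_addl.
- apply: Ck_boundedW B => //; rewrite ler_wpM2r ?exprn_ge0 ?(ltW e0)//.
  by rewrite (bigD1 i)//= addrCA lerDl addr_ge0// sumr_ge0.
Qed.

End directional.

(** * Extension of a function with bounded derivatives *)

Section glueing.
Variable R : realType.

(** A sequence of levels tending to infinity, by steps of at most one, so
    slowly that [H] stays under control along it. *)
Lemma slow_sequence (H : nat -> R) : exists (k : nat -> nat) (b : nat -> bool),
  [/\ forall j, k j.+1 = (k j + b j)%N,
      forall N, exists J, forall j, (J <= j)%N -> (N <= k j)%N &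
      forall j, (0 < k j)%N -> H (k j) <= 2 ^+ j].
Proof.
pose t j l := H l.+1 <= 2 ^+ j.+1.
pose k := fix k j := if j is j'.+1 then (k j' + t j' (k j'))%N else 0%N.
have kS j : k j.+1 = (k j + t j (k j))%N by [].
have k_homo i j : (i <= j)%N -> (k i <= k j)%N.
  move=> /subnKC <-; elim: (j - i)%N => [|n IH]; first by rewrite addn0.
  by rewrite addnS kS (leq_trans IH)// leq_addr.
exists k, (fun j => t j (k j)); split=> //.
- elim=> [|N [J HJ]]; first by exists 0%N.
  exists (maxn J (Num.bound (H N.+1))).+1 => j jJ.
  apply: leq_trans (k_homo _ _ jJ); rewrite kS.
  set n := maxn _ _.
  have : (N <= k n)%N by apply: HJ; exact: leq_maxl.
  rewrite leq_eqVlt => /orP[/eqP <-|]; last by move=> /leq_trans; apply; exact: leq_addr.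
  rewrite /t (_ : H N.+1 <= 2 ^+ n.+1) ?addn1// ltW// upper_nthrootP//.
  by rewrite ltnW// ltnS leq_maxr.
- elim=> [//|j IH]; rewrite kS; case: (boolP (t j (k j))) => [+ _|_].
    by rewrite /t addn1.
  rewrite addn0 => /IH /le_trans; apply.
  by rewrite ler_weXn2l// ler1n.
Qed.

(** [E k e] is an approximation of [f] at scale [e]. The telescoping series of
    the changes between the scales [2 ^- n] and [2 ^- n.+1], at levels given by
    [slow_sequence], converges in every C^k norm and its sum on [K] is [f]. *)
Lemma glue d (K : set 'rV[R]_d) (f : 'rV[R]_d -> R)
    (E : nat -> R -> 'rV[R]_d -> R) (H : nat -> R) :
  (forall k e, 0 < e -> H k * e <= 1 ->
    exists u, smooth_on setT (u : 'rV[R]_d -> R) /\ forall y, K y -> u y = E k e y) ->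
  (forall k e, 0 < e -> H k * e <= 1 -> forall y, K y -> `|f y - E k e y| <= e) ->
  (forall k e (b : bool), 0 < e -> H k * e <= 1 ->
    exists u, [/\ smooth_on setT (u : 'rV[R]_d -> R), Ck_bounded k setT e u &
      forall y, K y -> u y = E (k + b)%N (e / 2) y - E k e y]) ->
  exists2 g, smooth_on setT (g : 'rV[R]_d -> R) & forall y, K y -> g y = f y.
Proof.
move=> H1 H2 H3; have [k [b [kS kN kH]]] := slow_sequence H.
have [n0 Hn0] := kN 1%N.
pose e n : R := 2 ^- n.
have e0 n : 0 < e n by rewrite invr_gt0 exprn_gt0.
have He n : (n0 <= n)%N -> H (k n) * e n <= 1.
  by move=> /Hn0 /kH; rewrite ler_pdivrMr ?exprn_gt0// mul1r.
have [u0 [su0 u0E]] := H1 (k n0) (e n0) (e0 _) (He _ (leqnn _)).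
have /choice [u Hu] : forall j, exists u, [/\ smooth_on setT (u : 'rV[R]_d -> R),
    Ck_bounded (k (n0 + j)%N) setT (e (n0 + j)%N) u &
    forall y, K y -> u y = E (k (n0 + j).+1) (e (n0 + j).+1) y
                           - E (k (n0 + j)%N) (e (n0 + j)%N) y].
  move=> j; have [u [su bu uE]] := H3 (k (n0 + j)%N) (e (n0 + j)%N) (b (n0 + j)%N)
    (e0 _) (He _ (leq_addr _ _)).
  exists u; split=> // y Ky; rewrite uE// kS; congr (E _ _ _ - _).
  by rewrite /e exprS invfM mulrC.
have bu : series_bounded u.
  move=> l; have [J HJ] := kN l; exists J => j jJ; have [_ B _] := Hu j.
  apply: Ck_boundedW B; first by rewrite HJ// (leq_trans jJ)// leq_addl.
  rewrite /e lef_pV2 ?posrE ?exprn_gt0//.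
  by rewrite ler_weXn2l ?ler1n// leq_addl.
exists (fun x => u0 x + series_sum u x).
  move=> l; apply: Ck_on_add => //; first exact: openT.
  by apply: series_sum_smooth => // j; have [] := Hu j.
move=> y Ky; rewrite u0E//.
suff -> : series_sum u y = f y - E (k n0) (e n0) y by rewrite addrC subrK.
have partial n : \sum_(j < n) u j y =
    E (k (n0 + n)%N) (e (n0 + n)%N) y - E (k n0) (e n0) y.
  elim: n => [|n IH]; first by rewrite big_ord0 addn0 subrr.
  rewrite big_ord_recr/= IH; have [_ _ ->//] := Hu n.
  by rewrite addnS; ring.
apply: cvg_lim => //; apply/cvgrPdist_le => eps eps0.
have [n1 Hn1] := exp2N_lt eps0; exists n1 => // n /= n1n; rewrite partial.
have -> : f y - E (k n0) (e n0) y - (E (k (n0 + n)%N) (e (n0 + n)%N) y - E (k n0) (e n0) y)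
  = f y - E (k (n0 + n)%N) (e (n0 + n)%N) y by ring.
apply: (@le_trans _ _ (e (n0 + n)%N)).
  by apply: H2 => //; apply: He; exact: leq_addr.
by apply/ltW/Hn1; rewrite (leq_trans n1n)// leq_addl.
Qed.

End glueing.

Section extension.
Variables (R : realType) (d : nat) (U : set 'rV[R]_d) (w : 'rV[R]_d).
Hypothesis oU : open U.
Variables (K : set 'rV[R]_d) (A rho : R).
Hypothesis KA : forall x, K x -> `|x| <= A.
Hypothesis rho0 : 0 < rho.
Hypothesis KU : forall (y : 'rV[R]_d) (t : R) (z : 'rV[R]_d),
  K y -> 0 < t <= 1 -> `|z - y| < t * rho -> U (t *: w + z).
Variable f : 'rV[R]_d -> R.
Hypothesis bf : bounded_smooth U f.
Hypothesis f_ray : forall y, K y -> forall e : R, 0 < e -> exists2 t0 : R, 0 < t0 &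
  forall t : R, 0 < t < t0 -> `|f (t *: w + y) - f y| <= e.

Let K_thick e y : 0 < e -> K y -> thickening K rho e y.
Proof. by move=> e0 Ky; exists y => //; rewrite subrr normr0 mulr_gt0. Qed.

(** Inside [U] the error is exactly a difference of order [m]. The estimate at
    a point [y] of [K] is obtained at [t *: w + y], with [t] tending to [0]. *)
Lemma extrapolation_error m : exists B (N : nat), 0 <= B /\
  forall e, 0 < e -> N%:R * e <= 1 -> forall y, K y ->
  `|f y - shift_sum w (extrapolation R m) e f y| <= B * e ^+ m.
Proof.
have [B [B0 HB]] := finite_difference_bound w oU m bf.
pose q := extrapolation R m.
exists B, (m + size q).+1; split=> // e e0 Ne y Ky.
pose v := shift_sum w q e f.
have Ne' n : (n <= (m + size q).+1)%N -> n%:R * e <= 1.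
  by move=> nN; rewrite (le_trans _ Ne)// ler_wpM2r ?ler_nat ?(ltW e0).
have sv : smooth_on (thickening K rho e) v.
  apply: (shift_sum_smooth oU rho0 KU bf e0).
  by apply: Ne'; apply: leqW; exact: leq_addl.
apply/ler_addgt0Pr => eps eps0.
have eps2 : 0 < eps / 2 by rewrite divr_gt0.
have [t0 t00 Ht0] := f_ray Ky eps2.
have cv : {for y, continuous v} by apply: Ck_on_continuous (sv 0%N) (K_thick e0 Ky).
have /continuous_epsP /(_ _ eps2) [t1 t10 Ht1] := cv.
(* small enough for the ray condition, for the continuity of [v] at [y], and
   for the differences to stay in [U] *)
pose t := Num.min e (Num.min (t0 / 2) (t1 / (`|w| + 1) / 2)).
have w1 : 0 < `|w| + 1 by rewrite ltr_wpDl.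
have tpos : 0 < t by rewrite !lt_min e0 !divr_gt0.
have te : t <= e by rewrite ge_min lexx.
have tt0 : t < t0.
  apply: (@le_lt_trans _ _ (t0 / 2)); first by rewrite !ge_min lexx !orbT.
  by lra.
have tt1 : t * (`|w| + 1) < t1.
  rewrite -ltr_pdivlMr//; apply: (@le_lt_trans _ _ (t1 / (`|w| + 1) / 2)).
    by rewrite !ge_min lexx !orbT.
  have : 0 < t1 / (`|w| + 1) by rewrite divr_gt0.
  lra.
have D1 : `|f (t *: w + y) - v (t *: w + y)| <= e ^+ m * B.
  have -> : f (t *: w + y) - v (t *: w + y) =
    shift_eval ((1 - 'X) ^+ m) (fun i => f ((i%:R * e) *: w + (t *: w + y))).
    have -> : (1 - 'X) ^+ m = 1%:P - q * 'X :> {poly R}.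
      by rewrite extrapolationX opprB polyC1 addrCA subrr addr0.
    by rewrite shift_evalB shift_evalC shift_evalMX mul0r scale0r add0r mul1r.
  apply: HB => [|s /andP[s0 s1]]; first exact: ltW.
  rewrite addrA -scalerDl; apply: (KU Ky); last first.
    by rewrite subrr normr0 mulr_gt0// ltr_wpDl.
  rewrite ltr_wpDl//= (le_trans (lerD s1 te))//.
  have := Ne' m.+1; rewrite -natr1 mulrDl mul1r; apply.
  by rewrite ltnS leq_addr.
have D2 : `|f (t *: w + y) - f y| <= eps / 2 by apply: Ht0; rewrite tpos.
have D3 : `|v (t *: w + y) - v y| <= eps / 2.
  apply: Ht1; rewrite addrK normrZ (gtr0_norm tpos) (le_lt_trans _ tt1)//.
  by rewrite ler_wpM2l ?(ltW tpos)// lerDl.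
have -> : f y - shift_sum w (extrapolation R m) e f y =
  (f (t *: w + y) - v (t *: w + y)) - (f (t *: w + y) - f y) + (v (t *: w + y) - v y).
  by rewrite /v /q; ring.
rewrite (le_trans (ler_normD _ _))// (le_trans (lerD (ler_normB _ _) (lexx _)))//.
rewrite (le_trans (lerD (lerD D1 D2) D3))//; lra.
Qed.

(** Outside the thickening, where nothing is known on [v], the cutoff vanishes
    on a ball. *)
Lemma cutoff_mul (chi v : 'rV[R]_d -> R) (e delta : R) :
  0 < e -> 0 < delta -> 4 * delta <= e * rho ->
  smooth_on setT chi ->
  (forall x, (forall y, K y -> 2 * delta <= `|x - y|) -> chi x = 0) ->
  smooth_on (thickening K rho e) v ->
  smooth_on setT (fun x => chi x * v x) /\
  forall k M N, 0 <= M -> 0 <= N -> Ck_bounded k setT M chi ->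
    Ck_bounded k (thickening K rho e) N v ->
    Ck_bounded k setT (2 ^+ k * (M * N)) (fun x => chi x * v x).
Proof.
move=> e0 d0 de schi chi0 sv; have oT := @open_thickening _ _ K rho e.
have zero x : ~ thickening K rho e x ->
    forall x', ball x (2 * delta) x' -> 0 = chi x' * v x'.
  move=> nx x'; rewrite -ball_normE/= => xx'; rewrite chi0 ?mul0r// => y Ky.
  rewrite leNgt; apply/negP => yx'; apply: nx; exists y => //.
  rewrite -(subrKA x') (le_lt_trans (ler_normD _ _))//; lra.
split=> [k|k M N M0 N0 bchi bv].
  apply: Ck_on_local => x _; have [Tx|Tx] := pselect (thickening K rho e x).
    exists (thickening K rho e) => //; apply: Ck_on_mul => //.
    exact: Ck_on_sub (schi k).
  exists (ball x (2 * delta)); first by apply: ballxx; rewrite mulr_gt0.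
  apply: (Ck_on_eq _ (zero x Tx)); first exact: ball_open.
  by apply: Ck_on_cst; exact: ball_open.
apply: Ck_bounded_local => x _; have [Tx|Tx] := pselect (thickening K rho e x).
  exists (thickening K rho e) => //; apply: Ck_bounded_mul => //.
    exact: Ck_on_sub (schi k).
  exact: Ck_bounded_sub bchi.
exists (ball x (2 * delta)); first by apply: ballxx; rewrite mulr_gt0.
apply: (Ck_bounded_eq _ (zero x Tx)); first exact: ball_open.
have := Ck_bounded_cst (@ball_open _ _ x (2 * delta)) k (0 : R).
rewrite normr0; apply: Ck_boundedW => //.
by rewrite !mulr_ge0// exprn_ge0.
Qed.

(** The order [k + d + 2] exceeds by two the loss [e ^- (k + d)] of the
    cutoffs: one factor [e] absorbs the constants, which are collected in [H],
    and the other one is the announced bound. *)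
Lemma extension_level k : exists H : R, forall e, 0 < e -> H * e <= 1 ->
  let E k e := shift_sum w (extrapolation R (k + d + 2)) e f in
  [/\ exists u, smooth_on setT (u : 'rV[R]_d -> R) /\ forall y, K y -> u y = E k e y,
    forall y, K y -> `|f y - E k e y| <= e &
    forall b : bool, exists u, [/\ smooth_on setT (u : 'rV[R]_d -> R),
      Ck_bounded k setT e u &
      forall y, K y -> u y = E (k + b)%N (e / 2) y - E k e y]].
Proof.
pose m := (k + d + 2)%N.
have [C0 [C0_ge0 HC0]] := cutoff KA.
have [B [NB [B0 HB]]] := extrapolation_error m.
have /choice [r Hr] := fun b : bool => extrapolation_refine R m b.
have /choice [N HN] := fun b : bool => shift_sum_Ck_bounded oU rho0 KU m (r b).
have /choice [C HC] : forall b : bool, exists C, 0 <= C /\ forall e, 0 < e ->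
    (N b)%:R * e <= 1 -> Ck_bounded k (thickening K rho e) (C * e ^+ m)
     (shift_sum w ((1 - 'X) ^+ m * r b) e f).
  by move=> b; exact: HN.
pose c := Num.min 1 (rho / 4).
have c0 : 0 < c by rewrite lt_min ltr01 divr_gt0.
pose D b := 2 ^+ k * C0 k * C b * c ^- (k + d).
have D0 b : 0 <= D b.
  have [Cb _] := HC b.
  by rewrite /D !mulr_ge0 ?exprn_ge0 ?invr_ge0 ?exprn_ge0 ?(ltW c0).
pose sz b := (size ((1 - 'X) ^+ m * r b)).
exists (1 + B + NB%:R + (size (extrapolation R m))%:R +
  \sum_(b : bool) (D b + (N b)%:R + (sz b)%:R)) => e e0.
set S := \sum_b _ => He.
have S0 : 0 <= S by apply: sumr_ge0 => b _; rewrite !addr_ge0.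
have Sb b : D b + (N b)%:R + (sz b)%:R <= S.
  by rewrite /S (bigD1 b)//= lerDl sumr_ge0// => b' _; rewrite !addr_ge0.
have small a : a <= 1 + B + NB%:R + (size (extrapolation R m))%:R + S -> a * e <= 1.
  by move=> aH; rewrite (le_trans _ He)// ler_wpM2r// ltW.
have nn n : 0 <= n%:R :> R by [].
have e1 : e <= 1.
  rewrite -[e]mul1r small//.
  by move: (nn NB) (nn (size (extrapolation R m))); lra.
move=> E; split.
- pose delta := c * e.
  have delta0 : 0 < delta by rewrite mulr_gt0.
  have c1 : c <= 1 by rewrite ge_min lexx.
  have c4 : c <= rho / 4 by rewrite ge_min lexx orbT.
  have delta1 : delta <= 1 by rewrite mulr_ile1 ?(ltW c0) ?(ltW e0).
  have [chi [schi _ chi1 chi0]] := HC0 delta delta0 delta1.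
  exists (fun x => chi x * E k e x); split=> [|y Ky]; last by rewrite chi1// mul1r.
  apply: (cutoff_mul e0 delta0 _ schi chi0 _).1.
    rewrite /delta mulrA [leRHS]mulrC ler_wpM2r ?(ltW e0)//; lra.
  apply: (shift_sum_smooth oU rho0 KU bf e0); apply: small.
  by move: (nn NB); rewrite -/m; lra.
- move=> y Ky; apply: le_trans (HB e e0 _ y Ky) _.
    by apply: small; move: (nn (size (extrapolation R m))); lra.
  rewrite /m addn2 exprS mulrA exprS mulrCA ler_piMr ?(ltW e0)//.
  rewrite mulr_ile1 ?exprn_ge0 ?mulr_ge0 ?(ltW e0)//.
    by apply: small; move: (nn NB) (nn (size (extrapolation R m))); lra.
  by rewrite exprn_ile1 ?(ltW e0).
- move=> b; pose h := e / 2; have h0 : 0 < h by rewrite divr_gt0.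
  have he : h <= e by rewrite /h; lra.
  pose delta := c * h.
  have delta0 : 0 < delta by rewrite mulr_gt0.
  have c1 : c <= 1 by rewrite ge_min lexx.
  have c4 : c <= rho / 4 by rewrite ge_min lexx orbT.
  have delta1 : delta <= 1 by rewrite mulr_ile1 ?(ltW c0) ?(ltW h0)//; lra.
  have [chi [schi bchi chi1 chi0]] := HC0 delta delta0 delta1.
  pose v := shift_sum w ((1 - 'X) ^+ m * r b) h f.
  have [Cb0 Cb] := HC b.
  have smallh a : 0 <= a -> a <= D b + (N b)%:R + (sz b)%:R -> a * h <= 1.
    move=> a0 aS; apply: le_trans (small a _); first by rewrite ler_wpM2l.
    by move: (nn NB) (nn (size (extrapolation R m))) (Sb b); lra.
  have sv : smooth_on (thickening K rho h) v.
    apply: (shift_sum_smooth oU rho0 KU bf h0); apply: smallh => //.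
    by move: (D0 b) (nn (N b)); rewrite -/(sz b); lra.
  have [|su bu] := cutoff_mul h0 delta0 _ schi chi0 sv.
    rewrite /delta mulrA [leRHS]mulrC ler_wpM2r ?(ltW h0)//; lra.
  exists (fun x => chi x * v x); split=> //.
    apply: Ck_boundedW (bu k _ _ _ _ (bchi k) (Cb h h0 _)) => //.
    - rewrite (_ : 2 ^+ k * _ = D b * h * h); last first.
        rewrite /D /delta /m (exprD h (k + d) 2) exprMn; field.
        by rewrite !lt0r_neq0// exprn_gt0.
      apply: (@le_trans _ _ (1 * h)); last by rewrite mul1r.
      rewrite ler_wpM2r ?(ltW h0)//; apply: smallh => //.
      by move: (nn (N b)) (nn (sz b)); lra.
    - by rewrite mulr_ge0// invr_ge0 exprn_ge0// ltW.
    - by rewrite mulr_ge0// exprn_ge0// ltW.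
    - by apply: smallh => //; move: (D0 b) (nn (sz b)); lra.
  move=> y Ky; rewrite chi1// mul1r /E (addnAC k b d) (addnAC (k + d) b 2) -/m -/h.
  rewrite /v /shift_sum -Hr shift_evalB shift_evalMX shift_eval_comp2.
  have -> : (fun i => f ((i.*2.+2%:R * h) *: w + y)) =
            (fun i => f ((i.+1%:R * e) *: w + y)); last by [].
  apply/funext => i; congr (f (_ *: w + y)).
  have -> : i.*2.+2 = (i.+1 * 2)%N by rewrite muln2.
  by rewrite natrM /h mulrA mulrAC mulfK.
Qed.

Theorem smooth_extension :
  exists2 g, smooth_on setT (g : 'rV[R]_d -> R) & forall y, K y -> g y = f y.
Proof.
have /choice [H HH] := extension_level.
apply: (@glue R d K f (fun k e => shift_sum w (extrapolation R (k + d + 2)) e f) H).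
- by move=> k e e0 He; have [] := HH k e e0 He.
- by move=> k e e0 He; have [] := HH k e e0 He.
- by move=> k e b e0 He; have [_ _] := HH k e e0 He; apply.
Qed.

End extension.

(** * Plots and iterated partial derivatives *)

Section plots.
Variable R : realType.

(** [f] stands for its restriction to [K]. *)
Definition plot_smooth d (K : set 'rV[R]_d) (f : 'rV[R]_d -> R) :=
  forall m (V : set 'rV[R]_m) (p : 'rV[R]_m -> 'rV[R]_d), open V ->
    smooth_on V p -> (forall y, V y -> K (p y)) -> smooth_on V (f \o p).

Definition partials m (I : seq 'I_m) (f : 'rV[R]_m -> R) : 'rV[R]_m -> R :=
  foldr (fun i g => 'D_(delta_mx 0 i) g) f I.

Lemma smooth_on_partials m (U : set 'rV[R]_m) I f :
  smooth_on U f -> smooth_on U (partials I f).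
Proof. by move=> sf; elim: I => [//|i I IH]; exact: smooth_on_partial. Qed.

Lemma partials_eq m (U : set 'rV[R]_m) I f g : open U ->
  (forall x, U x -> f x = g x) -> forall x, U x -> partials I f x = partials I g x.
Proof.
move=> oU fg; elim: I => [//|i I IH] x Ux; apply: near_eq_derive.
have : nbhs x U by exact: open_nbhs_nbhs.
exact: filterS.
Qed.

Lemma bounded_smooth_partials m (U : set 'rV[R]_m) f : smooth_on U f ->
  (forall I, exists M, forall x, U x -> `|partials I f x| <= M) ->
  bounded_smooth U f.
Proof.
move=> sf bf; split=> // k; elim: k f {sf} bf => [|k IH] f bf.
  by have [M HM] := bf [::]; exists M.
apply: Ck_boundedS => [|i]; first exact: (bf [::]).
apply: IH => I; have [M HM] := bf (rcons I i); exists M => x Ux.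
by rewrite -[partials _ _](foldr_rcons (fun i g => 'D_(delta_mx 0 i) g) f I i) HM.
Qed.

(** Only the terms where every derivative hits the power survive on the zero
    locus of the coordinate. *)
Lemma partials_exp_coord m (W : set 'rV[R]_m) (j : 'I_m) n psi y : open W ->
  smooth_on W psi -> W y -> y 0 j = 0 ->
  partials (nseq n j) (fun x => x 0 j ^+ n * psi x) y = n`!%:R * psi y.
Proof.
move=> oW; elim: n psi => [|n IH] psi spsi Wy yj.
  by rewrite /= expr0 !mul1r.
pose psi' x := n.+1%:R * psi x + x 0 j * 'D_(delta_mx 0 j) psi x.
have spsi' : smooth_on W psi'.
  apply: smooth_on_add => //; apply: smooth_on_mul => //.
  - exact: smooth_on_cst.
  - exact: smooth_on_coord.
  - exact: smooth_on_partial.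
have := IH psi' spsi' Wy yj; rewrite /psi' yj mul0r addr0 factS natrM mulrA.
rewrite [n`!%:R * _]mulrC => <-.
have -> F : partials (nseq n.+1 j) F = partials (nseq n j) ('D_(delta_mx 0 j) F).
  by rewrite /partials -foldr_rcons -[rcons _ _]cats1 -[[:: j]]/(nseq 1 j) -nseqD addn1.
apply: (partials_eq (nseq n j) oW _ Wy) => x Wx.
have dx : is_derive x (delta_mx 0 j) (fun x : 'rV[R]_m => x 0 j) 1.
  by have := is_derive_coord j j x; rewrite eqxx.
have dX := is_deriveX n.+1 dx.
have [_ /(_ j) [/(_ x Wx) /derivableP dpsi _]] := spsi 1%N.
have [_ E] := is_deriveM dX dpsi.
rewrite (_ : (fun x : 'rV[R]_m => x 0 j ^+ n.+1 * psi x) =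
  (fun x : 'rV[R]_m => x 0 j) ^+ n.+1 * psi); last first.
  by apply/funext => z /=; rewrite !fctE.
rewrite E !fctE /GRing.scale/= exprS; ring.
Qed.

End plots.

(** * Smooth curves through fast converging sequences *)

Section curve.
Variables (R : realType) (d : nat).

Definition convex_closed (K : set 'rV[R]_d) := forall x y (t : R),
  K x -> K y -> 0 <= t <= 1 -> K (t *: x + (1 - t) *: y).

Lemma series_sum_single m (u : nat -> 'rV[R]_m -> R) y n :
  (forall i, i != n -> u i y = 0) -> series_sum u y = u n y.
Proof.
move=> H; apply: cvg_lim => //; apply: cvg_near_cst; exists n.+1 => // N /= nN.
by rewrite (bigD1 (Ordinal nN))//= big1 ?addr0// => i ni; exact: H.
Qed.

(** A smooth curve in [K] through a sequence that converges fast enough: it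
    leaves [x0] towards [x n] and comes back while the parameter is close to
    [2 ^- n]. The parameter is a coordinate of a larger space. *)
Lemma special_curve (K : set 'rV[R]_d) x0 m (t : 'I_m) :
  convex_closed K -> K x0 ->
  exists eta : nat -> R, (forall n, 0 < eta n) /\
  forall x : nat -> 'rV[R]_d, (forall n, K (x n)) ->
    (forall n, `|x n - x0| <= eta n) ->
  exists gam : 'rV[R]_m -> 'rV[R]_d, [/\ smooth_on setT gam,
    forall y, K (gam y),
    forall y y' : 'rV[R]_m, y 0 t = y' 0 t -> gam y = gam y' &
    forall n (y : 'rV[R]_m), y 0 t = 2 ^- n -> gam y = x n].
Proof.
move=> Kconv Kx0; have oT := @openT 'rV[R]_m.
have [b [b_supp b0 b01 _ bs]] := bump_exists R.
pose a n : R := 4 * 2 ^+ n.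
have a1 n : 1 <= a n.
  by have : 1 <= 2 ^+ n :> R by [rewrite exprn_ege1// ler1n]; rewrite /a; lra.
pose beta n (y : 'rV[R]_m) := b (a n * y 0 t - 4).
have betaE n : beta n = fun y => b ((a n *: y + const_mx (- 4)) 0 t).
  by apply/funext => y; rewrite !mxE.
have sbeta n : smooth_on setT (beta n).
  rewrite betaE => k.
  by apply: (@Ck_on_dilate _ _ _ _ setT (fun y => b (y 0 t))) => //; exact: (bs _ _).1.
have /choice [M HM] : forall n, exists M, 0 <= M /\ Ck_bounded n setT M (beta n).
  move=> n; have [M HM] := (bs m t).2 n; exists (a n ^+ n * `|M|); split.
    by rewrite mulr_ge0// exprn_ge0// (le_trans _ (a1 n)).
  rewrite betaE.
  apply: (@Ck_bounded_dilate _ _ _ _ setT (fun y => b (y 0 t))) => //.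
    exact: (bs _ _).1.
  exact: Ck_boundedW (leqnn n) (ler_norm M) HM.
have M0 n : 0 < M n + 1 by have [? _] := HM n; rewrite ltr_wpDl.
exists (fun n => 2 ^- n / (M n + 1)); split.
  by move=> n; rewrite divr_gt0// invr_gt0 exprn_gt0.
move=> x Kx xx0.
pose u j n y := (x n - x0) 0 j * beta n y.
have su j n : smooth_on setT (u j n).
  by apply: smooth_on_mul => //; exact: smooth_on_cst.
have bu j : series_bounded (u j).
  move=> k; exists k => n kn; have [Mn0 HMn] := HM n.
  have := Ck_bounded_scale oT ((x n - x0) 0 j) (sbeta n n) HMn.
  apply: Ck_boundedW => //.
  apply: (@le_trans _ _ (2 ^- n / (M n + 1) * (M n + 1))); last by rewrite divfK// gt_eqF.
  by rewrite ler_pM// ?(le_trans (coord_norm_le _ _))// lerDl.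
pose gam (y : 'rV[R]_m) : 'rV[R]_d := \row_j (x0 0 j + series_sum (u j) y).
(* these intervals are disjoint for different [n], since 5/4 < 2 * 3/4 *)
have beta_small n y : beta n y != 0 -> 3 / 4 < 2 ^+ n * y 0 t < 5 / 4.
  move=> by0; have : `|a n * y 0 t - 4| < 1.
    by rewrite ltNge; apply/negP => /b_supp H; rewrite /beta H eqxx in by0.
  rewrite ltr_norml /a -mulrA => /andP[H1 H2]; apply/andP; split; lra.
have beta_lt n n' y : (n < n')%N -> beta n y != 0 -> beta n' y = 0.
  move=> nn' /beta_small /andP[H1 H2]; apply/eqP; apply: contraT => /beta_small /andP[_].
  have : 2 * 2 ^+ n * y 0 t <= 2 ^+ n' * y 0 t.
    rewrite ler_wpM2r//.
      by rewrite -(@pmulr_rge0 _ (2 ^+ n)) ?exprn_gt0//; lra.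
    by rewrite -exprS ler_weXn2l ?ler1n.
  rewrite -mulrA; lra.
have beta_uniq n n' y : beta n y != 0 -> n' != n -> beta n' y = 0.
  move=> bn; rewrite neq_ltn => /orP[nn'|nn']; last exact: beta_lt bn.
  by apply/eqP; apply: contraT => /(beta_lt _ _ _ nn') H; rewrite H eqxx in bn.
have gamE y n : (forall n', n' != n -> beta n' y = 0) ->
    gam y = beta n y *: x n + (1 - beta n y) *: x0.
  move=> H; apply/rowP => j; rewrite !mxE (@series_sum_single _ _ _ n).
    by rewrite /u !mxE; ring.
  by move=> n' /H; rewrite /u => ->; rewrite mulr0.
exists gam; split.
- apply/smooth_on_rowP => // j; under eq_fun do rewrite mxE.
  apply: smooth_on_add => //; first exact: smooth_on_cst.
  by apply: series_sum_smooth => //; exact: bu.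
- move=> y; have [[n bn]|H] := pselect (exists n, beta n y != 0).
    rewrite (gamE y n); last by move=> n'; exact: beta_uniq.
    by apply: Kconv => //; exact: b01.
  rewrite (gamE y 0%N); last first.
    by move=> n' _; apply/eqP; apply: contraT => bn'; case: H; exists n'.
  by apply: Kconv => //; exact: b01.
- move=> y y' yy'; apply/rowP => j; rewrite !mxE; congr (_ + _).
  rewrite /series_sum.
  rewrite (_ : (fun n => \sum_(i < n) u j i y) = (fun n => \sum_(i < n) u j i y'))//.
  by apply/funext => n; apply: eq_bigr => i _; rewrite /u /beta yy'.
- move=> n y yn; have bn : beta n y = 1.
    by rewrite /beta yn /a mulfK ?subrr ?b0// gt_eqF// exprn_gt0.
  rewrite (gamE y n) ?bn ?subrr ?scale1r ?scale0r ?addr0//.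
  by move=> n' nn'; apply: (@beta_uniq n) => //; rewrite bn oner_eq0.
Qed.

End curve.

(** * Boundedness of the derivatives up to the boundary *)

Section bounds.
Variables (R : realType) (d : nat) (K : set 'rV[R]_d) (f : 'rV[R]_d -> R).
Variables (c : 'rV[R]_d) (r : R).
Hypothesis Kconv : convex_closed K.
Hypothesis r0 : 0 < r.
Hypothesis Kball : forall z, `|z - c| < r -> K z.
Hypothesis sf : plot_smooth K f.
Let U : set 'rV[R]_d := K^°.

Let oU : open U. Proof. exact: open_interior. Qed.
Let UK : U `<=` K. Proof. exact: interior_subset. Qed.

Lemma smooth_on_interior : smooth_on U f.
Proof.
apply: (sf (p := id)) => //.
by apply/smooth_on_rowP => // j; exact: smooth_on_coord.
Qed.

Section probe.
Variable gam : 'rV[R]_(d + 2) -> 'rV[R]_d.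
Let T : 'I_(d + 2) := rshift d ord0.
Let S : 'I_(d + 2) := rshift d ord_max.
Hypothesis sgam : smooth_on setT gam.
Hypothesis Kgam : forall y, K (gam y).
Hypothesis gamT : forall y y' : 'rV[R]_(d + 2), y 0 T = y' 0 T -> gam y = gam y'.

(** The plot moves from the curve [gam] towards a ball inside [K], at a speed
    that is quadratic in the last coordinate, so that it stays in [K] for both
    signs of this coordinate. *)
Definition probe (y : 'rV[R]_(d + 2)) : 'rV[R]_d :=
  (y 0 S ^+ 2) *: (c + lsubmx y) + (1 - y 0 S ^+ 2) *: gam y.
Let V : set 'rV[R]_(d + 2) := ball 0 (Num.min r 1).
Let oV : open V. Proof. exact: ball_open. Qed.

Let V_norm y : V y -> `|y| < r /\ `|y| < 1.
Proof. by rewrite /V -ball_normE/= sub0r normrN lt_min => /andP. Qed.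

Let probe_K y : V y -> K (probe y).
Proof.
move=> /V_norm [yr y1]; apply: Kconv => //.
  apply: Kball; rewrite addrC addKr (le_lt_trans _ yr)//.
  by apply/row_norm_le => // j; rewrite mxE coord_norm_le.
rewrite sqr_ge0/= -real_normK ?num_real// exprn_ile1//.
by rewrite (le_trans (coord_norm_le _ _))// ltW.
Qed.

Let smooth_probe W : open W -> smooth_on W probe.
Proof.
move=> oW; apply/smooth_on_rowP => // j.
rewrite (_ : (fun x => _) = (fun y : 'rV[R]_(d + 2) =>
   y 0 S ^+ 2 * (c 0 j + y 0 (lshift 2 j)) + (1 + -1 * y 0 S ^+ 2) * gam y 0 j)); last first.
  by apply/funext => y; rewrite !mxE mulN1r.
have s2 : smooth_on W (fun y : 'rV[R]_(d + 2) => y 0 S ^+ 2).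
  by apply: smooth_on_exp => //; exact: smooth_on_coord.
apply: smooth_on_add => //; apply: smooth_on_mul => //.
- by apply: smooth_on_add => //; [exact: smooth_on_cst|exact: smooth_on_coord].
- apply: smooth_on_add => //; first exact: smooth_on_cst.
  by apply: smooth_on_mul => //; exact: smooth_on_cst.
- apply: (@smooth_on_sub _ _ _ setT) => //.
  by have := (smooth_on_rowP gam openT).1 sgam; apply.
Qed.

Let W := V `&` probe @^-1` U.
Let oW : open W.
Proof.
apply: openI => //; apply: open_comp => // y _.
exact: Ck_on_continuous (smooth_probe openT 0%N) _.
Qed.

(** Adding [h] to a coordinate [v_i] moves the probe by [s^2 h] along the
    [i]-th axis. *)
Lemma is_derive_probe g i y : smooth_on U g -> W y ->
  is_derive y (delta_mx 0 (lshift 2 i)) (g \o probe)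
    (y 0 S ^+ 2 * 'D_(delta_mx 0 i) g (probe y)).
Proof.
move=> sg [_ /= Uy]; have [_ /(_ i) [/(_ _ Uy) dg _]] := sg 1%N.
set D := 'D_(delta_mx 0 i) g (probe y).
have dline : is_derive (y 0 S ^+ 2 *: (0 : R) + 0) (1 : R)
    (fun h : R => g (h *: delta_mx 0 i + probe y)) D.
  rewrite scaler0 addr0.
  exact: ((is_derive_lineP g (probe y) (delta_mx 0 i) D).1 (derivableP dg)).
have dd := is_derive_dilate dline.
apply: (is_derive_lineP _ _ _ _).2.
have -> : (fun h : R => (g \o probe) (h *: delta_mx 0 (lshift 2 i) + y)) =
  (fun h : R => g ((y 0 S ^+ 2 *: h + 0) *: delta_mx 0 i + probe y)); last exact: dd.
apply/funext => h /=; congr g.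
have ES : (h *: delta_mx 0 (lshift 2 i) + y) 0 S = y 0 S.
  by rewrite !mxE eqxx/= eq_rlshift mulr0 add0r.
have ET : gam (h *: delta_mx 0 (lshift 2 i) + y) = gam y.
  by apply: gamT; rewrite !mxE eqxx/= eq_rlshift mulr0 add0r.
rewrite /probe ES ET addr0; apply/rowP => j; rewrite !mxE eqxx/= eq_lshift/=.
rewrite [j == i]eq_sym /GRing.scale/=.
ring.
Qed.

Lemma partials_probe I y : W y ->
  partials (map (lshift 2) I) (f \o probe) y =
  y 0 S ^+ (2 * size I) * partials I f (probe y).
Proof.
elim: I y => [|i I IH] y Wy; first by rewrite muln0 expr0 mul1r.
rewrite [LHS](near_eq_derive _ (g := fun y : 'rV[R]_(d + 2) =>
    y 0 S ^+ (2 * size I) * (partials I f \o probe) y)); last first.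
  have : nbhs y W by exact: open_nbhs_nbhs.
  by apply: filterS => z /IH.
have dS : is_derive y (delta_mx 0 (lshift 2 i))
    (fun y : 'rV[R]_(d + 2) => y 0 S ^+ (2 * size I)) 0.
  apply/is_derive_epsP => e e0; exists 1 => // h _.
  by rewrite !mxE eqxx/= eq_rlshift !mulr0 add0r subr0 subrr normr0 mulr_ge0// ltW.
have dg := is_derive_probe i (smooth_on_partials I smooth_on_interior) Wy.
have [_ ->] := is_deriveM dS dg.
by rewrite scaler0 addr0 /GRing.scale/= mulrA -exprD mulnS [(_ * _ + 2)%N]addnC.
Qed.

(** After [2 * size I] derivatives in the last coordinate, the power of this
    coordinate in [partials_probe] has become a factorial; the derivative of a
    smooth function obtained in this way is bounded near the origin. *)
Lemma partials_probe_bounded I : exists2 e : R, 0 < e & exists M, forall y : 'rV[R]_(d + 2),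
  `|y| < e -> y 0 S = 0 -> U (gam y) -> `|partials I f (gam y)| <= M.
Proof.
pose n := (2 * size I)%N.
pose H := partials (nseq n S) (partials (map (lshift 2) I) (f \o probe)).
have sH : smooth_on V H.
  do 2 apply: smooth_on_partials.
  by apply: sf; [exact: oV|exact: smooth_probe|exact: probe_K].
have V0 : V 0 by apply: ballxx; rewrite lt_min r0/=.
have /continuous_epsP /(_ 1 ltr01) [e e0 He] := Ck_on_continuous (sH 0%N) V0.
exists (Num.min e (Num.min r 1)); first by rewrite !lt_min e0 r0/=.
exists (`|H 0| + 1) => y; rewrite lt_min => /andP[ye yr] yS Ugam.
have Vy : V y by rewrite /V -ball_normE/= sub0r normrN.
have py : probe y = gam y.
  by rewrite /probe yS expr0n/= scale0r add0r subr0 scale1r.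
have Wy : W y by split=> //=; rewrite py.
have HE : H y = n`!%:R * partials I f (gam y).
  have spsi : smooth_on W (fun y => partials I f (probe y)).
    apply: (smooth_on_comp oW oU) => [z []//||]; first exact: smooth_probe.
    exact: smooth_on_partials smooth_on_interior.
  rewrite /H (partials_eq (nseq n S) oW (fun y => @partials_probe I y) Wy).
  by rewrite -/n (@partials_exp_coord R _ W S n _ y oW spsi Wy yS) py.
apply: (@le_trans _ _ `|H y|).
  rewrite HE normrM ler_peMl// normr_nat.
  by rewrite ler1n fact_gt0.
have : `|H y - H 0| <= 1 by apply: He; rewrite subr0.
rewrite -lerBlDl; apply: le_trans.
exact: lerB_dist.
Qed.

End probe.

(** Otherwise the derivative would blow up along a sequence which converges to
    [x0] so fast that [special_curve] applies. *)
Lemma partials_bounded_near x0 I : K x0 -> exists2 e, 0 < e & exists M,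
  forall x, U x -> `|x - x0| < e -> `|partials I f x| <= M.
Proof.
move=> Kx0; apply: contrapT => nH.
have far (n : nat) e : 0 < e -> exists x, [/\ U x, `|x - x0| <= e &
    n%:R < `|partials I f x|].
  move=> e0; apply: contrapT => nx; apply: nH; exists e => //; exists n%:R => x Ux xe.
  by rewrite leNgt; apply/negP => nI; apply: nx; exists x; split=> //; exact: ltW.
pose T : 'I_(d + 2) := rshift d ord0; pose S : 'I_(d + 2) := rshift d ord_max.
have [eta [eta0 curve]] := @special_curve R d K x0 _ T Kconv Kx0.
have /choice [x Hx] := fun n => far n (eta n) (eta0 n).
have [|n|gam [sgam Kgam gamT gamx]] := curve x.
- by move=> n; have [Ux _ _] := Hx n; exact: UK.
- by have [] := Hx n.
have [e e0 [M HM]] := partials_probe_bounded sgam Kgam gamT I.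
have [n1 Hn1] := exp2N_lt e0.
pose n := maxn n1 (Num.bound `|M|).
pose y : 'rV[R]_(d + 2) := 2 ^- n *: delta_mx 0 T.
have yT : y 0 T = 2 ^- n by rewrite !mxE !eqxx mulr1.
have gy : gam y = x n by exact: gamx.
have [Ux _] := Hx n; apply/negP; rewrite -leNgt.
apply: (@le_trans _ _ M).
  rewrite -gy; apply: HM; last by rewrite gy.
    rewrite normrZ (@le_lt_trans _ _ (2 ^- n))// ?Hn1 ?leq_maxl//.
    rewrite ger0_norm ?invr_ge0 ?exprn_ge0// ler_piMr ?invr_ge0 ?exprn_ge0//.
    exact: norm_delta_le.
  by rewrite !mxE eqxx/= eq_rshift mulr0.
rewrite (le_trans (ler_norm _))// (le_trans (ltW (archi_boundP (normr_ge0 _))))//.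
by rewrite ler_nat leq_maxr.
Qed.

Lemma bounded_smooth_interior : compact K -> bounded_smooth U f.
Proof.
move=> /compact_near_coveringP cK.
apply: bounded_smooth_partials; first exact: smooth_on_interior.
move=> I; have := cK R (+oo%R) (fun M x => U x -> `|partials I f x| <= M) _.
case.
  move=> x Kx; have [e e0 [M HM]] := partials_bounded_near I Kx.
  exists (ball x e, [set N | M <= N]) => /=.
    split; first exact: nbhsx_ballx.
    exact: nbhs_pinfty_ge (num_real _).
  move=> [x' N] /= [xx' MN] Ux'; apply: le_trans MN; apply: HM => //.
  by move: xx'; rewrite -ball_normE/= distrC.
move=> M [_ HM]; exists (M + 1) => x Ux; apply: HM => //; last exact: UK.
by rewrite ltrDl.
Qed.

(** The plot [s |-> y + s^2 (c - x0)] is continuous at [s = 0]. *)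
Lemma plot_smooth_ray x0 y : K y -> `|y - x0| < r -> forall e, 0 < e ->
  exists2 t0, 0 < t0 & forall t : R, 0 < t < t0 ->
    `|f (t *: (c - x0) + y) - f y| <= e.
Proof.
move=> Ky yr e e0; pose w := c - x0.
pose V : set 'rV[R]_1 := ball 0 1.
have oV : open V by exact: ball_open.
pose p (z : 'rV[R]_1) : 'rV[R]_d := (z 0 0 ^+ 2) *: w + y.
have sp : smooth_on V p.
  apply/smooth_on_rowP => // j; rewrite (_ : (fun z => _) =
    (fun z : 'rV[R]_1 => z 0 0 ^+ 2 * w 0 j + y 0 j)); last first.
    by apply/funext => z; rewrite !mxE.
  apply: smooth_on_add => //; last exact: smooth_on_cst.
  apply: smooth_on_mul => //; last exact: smooth_on_cst.
  by apply: smooth_on_exp => //; exact: smooth_on_coord.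
have Kp z : V z -> K (p z).
  rewrite /V -ball_normE/= sub0r normrN => z1.
  have -> : p z = (z 0 0 ^+ 2) *: (c + (y - x0)) + (1 - z 0 0 ^+ 2) *: y.
    by apply/rowP => j; rewrite !mxE; ring.
  apply: Kconv => //; first by apply: Kball; rewrite addrC addKr.
  rewrite sqr_ge0/= -real_normK ?num_real// exprn_ile1//.
  by rewrite (le_trans (coord_norm_le _ _))// ltW.
have V0 : V 0 by exact: ballxx.
have /continuous_epsP /(_ e e0) [t0 t00 Ht0] :=
  Ck_on_continuous (sf oV sp Kp 0%N) V0.
exists (t0 ^+ 2) => [|t /andP[tpos tt0]]; first exact: exprn_gt0.
have := Ht0 (const_mx (Num.sqrt t)); rewrite subr0 /= /p !mxE expr0n/= scale0r add0r.
rewrite sqr_sqrtr ?(ltW tpos)//; apply; apply/row_norm_lt => // j; rewrite mxE.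
rewrite ger0_norm ?sqrtr_ge0// -(ltr_pXn2r (n := 2))// ?nnegrE ?sqrtr_ge0 ?(ltW t00)//.
by rewrite sqr_sqrtr// ltW.
Qed.

Theorem local_extension x0 : compact K -> K x0 ->
  exists2 g, smooth_on setT (g : 'rV[R]_d -> R) &
    forall y, K y -> `|y - x0| < r / 2 -> g y = f y.
Proof.
move=> cK Kx0; pose K' := K `&` [set y | `|y - x0| < r / 2].
have r2 : 0 < r / 2 by rewrite divr_gt0.
have KU (y : 'rV[R]_d) (t : R) (z : 'rV[R]_d) :
    K' y -> 0 < t <= 1 -> `|z - y| < t * (r / 2) -> U (t *: (c - x0) + z).
  move=> [Ky yr] /andP[t0 t1] zy.
  have KK z' : `|z' - y| < t * (r / 2) -> K (t *: (c - x0) + z').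
    move=> z'y.
    (* a combination of [y] and of a point of the ball around [c] *)
    have -> : t *: (c - x0) + z' = t *: (c + ((y - x0) + t^-1 *: (z' - y))) + (1 - t) *: y.
      by apply/rowP => j; rewrite !mxE; field; rewrite gt_eqF.
    apply: Kconv => //; last by rewrite (ltW t0).
    apply: Kball; rewrite addrC addKr (le_lt_trans (ler_normD _ _))//.
    rewrite [ltRHS](splitr r) ltrD// normrZ gtr0_norm ?invr_gt0//.
    by rewrite mulrC ltr_pdivrMr// mulrC.
  apply/nbhs_ballP; exists (t * (r / 2) - `|z - y|); first by rewrite /= subr_gt0.
  move=> x; rewrite -ball_normE/= => xz.
  rewrite -[x](subrK (t *: (c - x0))) addrC; apply: KK.
  have -> : x - t *: (c - x0) - y = - (t *: (c - x0) + z - x) + (z - y).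
    by apply/rowP => j; rewrite !mxE; ring.
  by rewrite (le_lt_trans (ler_normD _ _))// normrN -ltrBrDr.
have [A [_ HA]] := compact_bounded cK.
have K'A y : K' y -> `|y| <= A + 1 by move=> [Ky _]; apply: HA Ky; rewrite ltrDl.
have [|g sg gE] := @smooth_extension R d U (c - x0) oU K' (A + 1) (r / 2) K'A r2 KU f
  (bounded_smooth_interior cK).
  move=> y [Ky yr] e e0; apply: plot_smooth_ray => //.
  by rewrite (lt_trans yr)//; lra.
by exists g => // y Ky yx; apply: gE; split.
Qed.

End bounds.

(** * Reduction to convex sets with interior points *)

Section affine_hull.
Variables (R : realType) (d : nat).

Lemma convex_setE (K : set 'rV[R]_d) :
  convex_set (K : set (convex_lmodType 'rV[R]_d)) -> convex_closed K.
Proof.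
move=> cK x y t Kx Ky /andP[t0 t1].
by have := cK x y (Itv01 t0 t1) (mem_set Kx) (mem_set Ky) => /set_mem.
Qed.

(** The simplex spanned by [x0] and the points [x0 + row i M] contains a cube.
    By induction: a combination is the midpoint of the combination of the first
    vectors and of a multiple of the last one, with doubled coefficients. *)
Lemma convex_small_combination (K : set 'rV[R]_d) x0 n (M : 'M[R]_(n, d)) (u : 'rV[R]_n) :
  convex_closed K -> K x0 -> (forall i, K (x0 + row i M)) ->
  (forall i, 0 <= u 0 i <= 2 ^- n) -> K (x0 + u *m M).
Proof.
move=> Kconv Kx0 KM u01; rewrite mulmx_sum_row.
suff H k (v : 'I_k -> 'rV[R]_d) (a : 'I_k -> R) : (forall i, K (x0 + v i)) ->
    (forall i, 0 <= a i <= 2 ^- k) -> K (x0 + \sum_i a i *: v i).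
  exact: (H n (fun i => row i M) (fun i => u 0 i)).
elim: k v a => [|k IH] v a Kv a01; first by rewrite big_ord0 addr0.
have Kseg i t : 0 <= t <= 1 -> K (x0 + t *: v i).
  move=> t01; have := Kconv _ _ t (Kv i) Kx0 t01.
  by rewrite scalerDr addrAC -scalerDl addrCA subrr addr0 scale1r.
have half : 0 <= (2^-1 : R) <= 1 by apply/andP; split; lra.
have p1 : 1 <= 2 ^+ k :> R by rewrite exprn_ege1// ler1n.
have a2 i : 0 <= 2 * a i <= 2 ^- k.
  have /andP[a0 a1] := a01 i; rewrite mulr_ge0//=.
  by rewrite mulrC -ler_pdivlMr// -invfM mulrC -exprS.
have K1 := IH (fun i => v (widen_ord (leqnSn k) i))
  (fun i => 2 * a (widen_ord (leqnSn k) i))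
  (fun i => Kv _) (fun i => a2 _).
have /Kseg - /(_ ord_max) K2 : 0 <= 2 * a ord_max <= 1.
  have /andP[-> /le_trans -> //] := a2 ord_max.
  by rewrite invf_le1// exprn_gt0.
have := Kconv _ _ _ K1 K2 half; congr K.
rewrite big_ord_recr/= !scalerDr scaler_sumr.
have E : 1 - 2^-1 = 2^-1 :> R by lra.
rewrite E addrACA -scalerDl.
have -> : 2^-1 + 2^-1 = 1 :> R by lra.
rewrite scale1r; congr (_ + (_ + _)).
  by apply: eq_bigr => i _; rewrite scalerA mulKf.
by rewrite scalerA mulKf.
Qed.

(** A maximal free family of directions from [x0] to points of [K]. *)
Lemma affine_hull_basis (K : set 'rV[R]_d) x0 : exists n (M : 'M[R]_(n, d)),
  [/\ row_free M, forall i, K (x0 + row i M) &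
      forall x, K x -> (x - x0 <= M)%MS].
Proof.
pose P n := `[< exists M : 'M[R]_(n, d), row_free M /\ forall i, K (x0 + row i M) >].
have P0 : exists n, P n.
  by exists 0%N; apply/asboolP; exists 0; split=> [|[]//]; rewrite /row_free mxrank0.
have Pd n : P n -> (n <= d)%N.
  by move=> /asboolP [M [/eqP fM _]]; have := rank_leq_col M; rewrite fM.
case: (ex_maxnP P0 Pd) => n /asboolP [M [fM KM]] nmax.
exists n, M; split=> // x Kx; apply: contraT => nx.
have : P (n + 1)%N.
  apply/asboolP; exists (col_mx M (x - x0)); split.
    rewrite /row_free eqn_leq rank_leq_row/= -addsmxE [leqLHS]addn1.
    have := ltn_leqif (mxrank_leqif_sup (addsmxSl M (x - x0))).
    rewrite (eqP fM) => ->.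
    by apply: contra nx; apply: submx_trans; exact: addsmxSr.
  move=> i; case: (splitP i) => j ij.
    by rewrite (_ : i = lshift 1 j) ?rowKu//; exact/val_inj.
  rewrite (_ : i = rshift n j) ?rowKd; last exact/val_inj.
  rewrite [row j _](_ : _ = x - x0) 1?addrC ?subrK//.
  by apply/rowP => l; rewrite !mxE (ord1 j).
by move=> /nmax; rewrite addn1 ltnn.
Qed.

Lemma smooth_on_affine_map m n (V : set 'rV[R]_m) (p : 'rV[R]_m -> 'rV[R]_n)
    (M : 'M[R]_(n, d)) b : open V -> smooth_on V p ->
  smooth_on V (fun y => b + p y *m M).
Proof.
move=> oV sp; apply/smooth_on_rowP => // j.
rewrite (_ : (fun y => _) = (fun y => b 0 j + \sum_i p y 0 i * M i j)); last first.
  by apply/funext => y; rewrite !mxE.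
apply: smooth_on_add => //; first exact: smooth_on_cst.
move=> k; apply: Ck_on_sum => // i; apply: Ck_on_mul => //; last exact: Ck_on_cst.
by have := sp k => /(Ck_on_rowP _ _ oV); apply.
Qed.

End affine_hull.

Section compact.
Variables (R : realType) (d : nat) (K : set 'rV[R]_d) (f : 'rV[R]_d -> R).

(** [A] parametrizes the affine hull of [K], in which [K] has interior points,
    and [B] is an affine left inverse of [A] defined on the whole space. *)
Theorem local_extension_compact x0 : convex_closed K -> compact K ->
  plot_smooth K f -> K x0 ->
  exists2 g, smooth_on setT (g : 'rV[R]_d -> R) & exists2 e : R, 0 < e &
    forall y, K y -> `|y - x0| < e -> g y = f y.
Proof.
move=> Kconv cK sf Kx0.
have [n [M [fM KM hull]]] := affine_hull_basis K x0.
pose A (u : 'rV[R]_n) := x0 + u *m M.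
pose B (y : 'rV[R]_d) : 'rV[R]_n := - (x0 *m pinvmx M) + y *m pinvmx M.
have BA u : B (A u) = u by rewrite /B /A mulmxDl addrA addNr add0r mulmxKp.
have AB y : K y -> A (B y) = y.
  move=> /hull yM; rewrite /A /B addrC [- _ + _]addrC -mulmxBl mulmxKpV// subrK//.
have oTn := @openT 'rV[R]_n; have oTd := @openT 'rV[R]_d.
have sA : smooth_on setT A by exact: smooth_on_affine_map oTn (@smooth_on_id R n).
have sB : smooth_on setT B by exact: smooth_on_affine_map oTd (@smooth_on_id R d).
have cB : continuous B by move=> y; exact: Ck_on_continuous (sB 0%N) _.
pose K1 : set 'rV[R]_n := A @^-1` K.
have K1E : K1 = B @` K.
  apply/seteqP; split=> [u Ku|_ [y Ky <-]]; first by exists (A u).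
  by rewrite /K1 /= AB.
have cK1 : compact K1.
  by rewrite K1E; apply: continuous_compact => //; exact: continuous_subspaceT.
have K1conv : convex_closed K1.
  move=> u v t Ku Kv t01; rewrite /K1/=.
  have -> : A (t *: u + (1 - t) *: v) = t *: A u + (1 - t) *: A v; last exact: Kconv.
  rewrite /A mulmxDl -!scalemxAl !scalerDr addrACA -scalerDl.
  by rewrite [t + _]addrC subrK scale1r.
pose r : R := 2 ^- n / 2.
have r0 : 0 < r by rewrite divr_gt0// invr_gt0 exprn_gt0.
have K1ball z : `|z - const_mx r| < r -> K1 z.
  move=> /(row_norm_lt _ r0) zr; apply: convex_small_combination => // i.
  have := zr i; rewrite !mxE ltr_norml => /andP[z1 z2].
  have -> : 2 ^- n = r + r by rewrite /r -splitr.
  by apply/andP; split; lra.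
have sf1 : plot_smooth K1 (f \o A).
  move=> m V p oV sp Kp; apply: (sf m V (A \o p)) => //.
  exact: smooth_on_affine_map.
have A0 : A 0 = x0 by rewrite /A mul0mx addr0.
have K10 : K1 0 by rewrite /K1/= A0.
have [g sg gE] := local_extension K1conv r0 K1ball sf1 cK1 K10.
exists (g \o B); first by apply: (smooth_on_comp (W := setT)).
have [|e e0 He] := (continuous_epsP B x0).1 (cB x0) (r / 4); first by rewrite divr_gt0.
have B0 : B x0 = 0 by rewrite -[X in B X]A0 BA.
exists e => // y Ky /He; rewrite B0 subr0 => By.
rewrite /= gE ?subr0; first by rewrite /= AB.
  by rewrite K1E; exists y.
by rewrite (le_lt_trans By)//; lra.
Qed.

End compact.

(** * Sikorski and diffeological smoothness *)

Section extend_by0.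
Variables (R : realType) (d : nat) (K : set 'rV[R]_d).

Definition extend_by0 (V : zmodType) (F : K -> V) (x : 'rV[R]_d) : V :=
  if pselect (x \in K) is left xK then F (exist _ x xK) else 0.

Lemma extend_by0E (V : zmodType) (F : K -> V) (x : K) :
  extend_by0 F (\val x) = F x.
Proof.
rewrite /extend_by0; case: pselect => [xK|]; last by case; exact: (valP x).
by congr F; exact: val_inj.
Qed.

End extend_by0.

Section directions.
Variables (R : realType) (d n : nat) (K : set 'rV[R]_d).
Implicit Types F : K -> 'rV[R]_n.

(** Near each point, the components of [F \o p] are smooth functions composed
    with [p]. *)
Lemma sikorski_diffeological F :
  sikorski_smooth (@subspace_sikorski R d K) (@cartesian_sikorski R n) F ->
  diffeologically_smooth (@subset_diffeology R d K) (@cartesian_diffeology R n) F.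
Proof.
move=> sF m U p [oU [p0 sp0 pE]]; split=> //.
exists (extend_by0 (F \o p)); last by move=> u; rewrite extend_by0E.
apply/smooth_on_rowP => // j k; apply: Ck_on_local => y Uy.
have Fj : subspace_sikorski (K := K) ((fun z : 'rV[R]_n => z 0 j) \o F).
  by apply: sF => l; apply: Ck_on_coord; exact: openT.
pose yU : U := exist _ y (mem_set Uy).
have [W [yW [g sg gE]]] := Fj (p yU).
have py : \val (p yU) = p0 y by rewrite pE.
exists (U `&` p0 @^-1` W^°).
  by split=> //=; rewrite /interior -py.
have oW : open (U `&` p0 @^-1` W^°).
  rewrite openE => z [Uz Wz]; apply: filterI; first exact: open_nbhs_nbhs.
  exact: (Ck_on_continuous (sp0 0%N) Uz) (open_nbhs_nbhs (conj (@open_interior _ W) Wz)).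
apply: (Ck_on_eq (f := g \o p0) oW).
  move=> z [Uz Wz]; pose zU : U := exist _ z (mem_set Uz).
  have pz : p0 z = \val (p zU) by rewrite pE.
  have Ez : extend_by0 (F \o p) z = F (p zU) := extend_by0E (F \o p) zU.
  by rewrite Ez /= pz gE// -pz; exact: interior_subset Wz.
apply: (@Ck_on_comp _ k _ _ _ setT) => //; first exact: openT.
move=> i; apply: (Ck_on_sub (W := U)); first by move=> z [].
by have := sp0 k => /(Ck_on_rowP _ _ oU); apply.
Qed.

(** By local closedness, a small closed ball around a point of [K] cuts a
    compact convex subset out of [K]. *)
Lemma diffeological_sikorski F : locally_closed K -> convex_set K ->
  diffeologically_smooth (@subset_diffeology R d K) (@cartesian_diffeology R n) F ->
  sikorski_smooth (@subspace_sikorski R d K) (@cartesian_sikorski R n) F.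
Proof.
move=> [Op [Cl [oO cC KOC]]] /convex_setE Kconv sF g sg x.
have KO y : K y <-> Op y /\ Cl y by rewrite KOC.
have Kx : K (\val x) by exact: set_mem (valP x).
pose f := extend_by0 (g \o F : K -> R).
have sf : plot_smooth K f.
  move=> m V p oV sp Kp.
  have Kp' (v : V) : p (\val v) \in K by apply/mem_set/Kp; exact: set_mem (valP v).
  have [|_ [G sG GE]] := sF m V (fun v : V => exist _ (p (\val v)) (Kp' v) : K).
    by split=> //; exists p.
  have sgG := smooth_on_comp oV openT (fun _ _ => I) sG sg.
  move=> k; apply: Ck_on_eq (sgG k) => // z Vz.
  pose zV : V := exist _ z (mem_set Vz).
  rewrite /= -[z]/(\val zV) -GE.
  exact/esym/(extend_by0E (g \o F : K -> R) (exist _ (p (\val zV)) (Kp' zV) : K)).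
have : nbhs (\val x) Op.
  by apply: open_nbhs_nbhs; split=> //; have [] := (KO _).1 Kx.
move=> /nbhs_ballP [e /= e0 eO].
have e2 : 0 < e / 2 by rewrite divr_gt0.
pose D : set 'rV[R]_d := [set y | `|y - \val x| <= e / 2].
have D_closed : closed D.
  rewrite (_ : D = closed_ball (\val x) (e / 2)); first exact: closed_ball_closed.
  by rewrite closed_ballE//; apply/seteqP; split=> y; rewrite /D /closed_ball_/= distrC.
have KD : K `&` D = Cl `&` D.
  apply/seteqP; split=> y [Ky Dy]; split=> //; first by have [] := (KO y).1 Ky.
  apply/KO; split=> //; apply: eO; rewrite -ball_normE/= distrC.
  by apply: le_lt_trans Dy _; lra.
have KD_compact : compact (K `&` D).
  rewrite KD; apply: bounded_closed_compact; last exact: closedI.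
  exists (`|\val x| + e / 2); split; first exact: num_real.
  move=> M xM y [_ Dy] /=; apply: le_trans (ltW xM).
  by rewrite -[y](subrK (\val x)) (le_trans (ler_normD _ _))// addrC lerD2l.
have KD_convex : convex_closed (K `&` D).
  move=> y z t [Ky Dy] [Kz Dz] t01; split; first exact: Kconv.
  rewrite /D/=; have -> : t *: y + (1 - t) *: z - \val x =
      t *: (y - \val x) + (1 - t) *: (z - \val x).
    by apply/rowP => j; rewrite !mxE; ring.
  have /andP[t0 t1] := t01.
  rewrite (le_trans (ler_normD _ _))// !normrZ (ger0_norm t0) ger0_norm ?subr_ge0//.
  rewrite [leRHS](_ : _ = t * (e / 2) + (1 - t) * (e / 2)); last by ring.
  by rewrite lerD// ler_wpM2l// subr_ge0.
have sfD : plot_smooth (K `&` D) f.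
  by move=> m V p oV sp Kp; apply: sf => // y /Kp [].
have Dx : D (\val x) by rewrite /D/= subrr normr0 ltW.
have [h sh [e' e'0 hE]] := local_extension_compact KD_convex KD_compact sfD (conj Kx Dx).
exists (ball (\val x) (Num.min (e / 2) e')); split.
  by apply: nbhsx_ballx; rewrite lt_min e2.
exists h => // y; rewrite -ball_normE/= lt_min distrC => /andP[y1 y2].
rewrite hE//; first exact: extend_by0E.
split; first exact: set_mem (valP y).
exact: ltW.
Qed.

End directions.

Unset Implicit Arguments.

Theorem mainTheorem7 (R : realType) (d n : nat) (K : set 'rV[R]_d)
    (K_locally_closed : locally_closed K) (K_convex : convex_set K)
    (F : K -> 'rV[R]_n) :
  diffeologically_smooth (@subset_diffeology R d K) (@cartesian_diffeology R n) F
  <-> sikorski_smooth (@subspace_sikorski R d K) (@cartesian_sikorski R n) F.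
Proof.
split; first exact: diffeological_sikorski.
exact: sikorski_diffeological.
Qed.
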